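(* Let $(R,\mathfrak m)$ be a local ring, $M\neq 0$ a finitely generated $R$-module of dimension $d$ and $I$ a proper ideal of $R$. Then $$\mathrm{N.dim}_R(H_I^d(M))\le d.$$
   Context: Local ring means commutative Noetherian local ring. $H^d_I(M)$ is the $d$-th local cohomology module of $M$ with respect to $I$ (an Artinian $R$-module, since $d=\dim M$). Let $(A,\mathfrak n)$ be a commutative quasi-local ring and $X$ an Artinian $A$-module. The N.dimension (Noetherian dimension) $\mathrm{N.dim}_A(X)$ is defined inductively: $\mathrm{N.dim}_A(X)=-1$ when $X=0$; for an integer $r\ge 0$, put $\mathrm{N.dim}_A(X)=r$ when $\mathrm{N.dim}_A(X)<r$ is false and for every ascending chain $X_0\subseteq X_1\subseteq X_2\subseteq\cdots$ of submodules of $X$ there exists an integer $n$ such that $\mathrm{N.dim}_A(X_{m+1}/X_m)<r$ for all $m\ge n$. *)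

(* Defs.v *)
From HB Require Import structures.
From mathcomp Require Import all_boot all_order all_algebra.
From mathcomp Require Import boolp.

Set Implicit Arguments.
Unset Strict Implicit.
Unset Printing Implicit Defensive.

Import GRing.Theory.
Local Open Scope ring_scope.
Local Open Scope quotient_scope.

(* Conventions.  Proper ideals and prime ideals of R are mathcomp's [idealr R]
   and [prime_idealr R]; arbitrary ideals are submodules of the regular module
   R^o.  Submodules of V are mathcomp's [submodClosed V], boolean predicates;
   [`[< _ >]] turns an arbitrary proposition into a boolean, so every submodule
   is of this form. *)

Section Submodule.
Variables (R : comNzRingType) (V : lmodType R) (U : submodClosed V).

Record submod := Submod { submod_val : V; submod_valP : submod_val \in U }.

HB.instance Definition _ := [isSub for submod_val].
HB.instance Definition _ := [Choice of submod by <:].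
HB.instance Definition _ := [SubChoice_isSubLmodule of submod by <:].

End Submodule.

Section QuotientModule.
Variables (R : comNzRingType) (V : lmodType R) (W : submodClosed V).

(* [submodClosed] does not inherit from [zmodClosed], which mathcomp's additive
   quotient requires, so the underlying predicate is given that structure. *)
Definition mod_pred : {pred V} := fun x => x \in W.

Fact mod_pred_closed : zmod_closed mod_pred.
Proof. exact: GRing.submod_closedB (submodClosedP W). Qed.

HB.instance Definition _ := GRing.isZmodClosed.Build V mod_pred mod_pred_closed.

Definition quot_mod := Quotient.quot mod_pred.
HB.instance Definition _ := GRing.Zmodule.on quot_mod.
HB.instance Definition _ := EqQuotient.on quot_mod.

Definition quot_scale (a : R) (x : quot_mod) : quot_mod :=
  \pi_quot_mod (a *: (repr x : V)).

Lemma quot_eqE (x y : V) :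
  (\pi_quot_mod x == \pi_quot_mod y) = (x - y \in W).
Proof. by rewrite -(Quotient.idealrBE mod_pred x y). Qed.

Lemma quot_scale_pi (a : R) (x : V) :
  quot_scale a (\pi_quot_mod x) = \pi_quot_mod (a *: x).
Proof.
by apply/eqP; rewrite quot_eqE -scalerBr rpredZ // -quot_eqE reprK.
Qed.

Lemma quot_piD (x y : V) :
  \pi_quot_mod (x + y) = \pi_quot_mod x + \pi_quot_mod y.
Proof. rewrite -[LHS]/(\pi_(Quotient.quot mod_pred) (x + y)) raddfD; reflexivity. Qed.

Fact quot_scaleA (a b : R) (x : quot_mod) :
  quot_scale a (quot_scale b x) = quot_scale (a * b) x.
Proof. by rewrite -[x]reprK (quot_scale_pi b) !quot_scale_pi scalerA. Qed.

Fact quot_scale1 (x : quot_mod) : quot_scale 1 x = x.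
Proof. by rewrite -[x]reprK quot_scale_pi scale1r. Qed.

Fact quot_scaleDr (a : R) (x y : quot_mod) :
  quot_scale a (x + y) = quot_scale a x + quot_scale a y.
Proof.
by rewrite -[x]reprK -[y]reprK -quot_piD !quot_scale_pi scalerDr quot_piD.
Qed.

Fact quot_scaleDl (x : quot_mod) (a b : R) :
  quot_scale (a + b) x = quot_scale a x + quot_scale b x.
Proof. by rewrite -[x]reprK !quot_scale_pi scalerDl quot_piD. Qed.

HB.instance Definition _ := GRing.Zmodule_isLmodule.Build R quot_mod
  quot_scaleA quot_scale1 quot_scaleDr (fun x a b => quot_scaleDl x a b).

End QuotientModule.

Section SubQuotient.
Variables (R : comNzRingType) (V : lmodType R) (U W : submodClosed V).

Definition restr_pred : {pred submod U} := fun u => val u \in W.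

Fact restr_pred_closed : submod_closed restr_pred.
Proof.
split=> [|a u v]; first exact: rpred0.
by move=> uW vW; apply: (rpredD (S := W)) => //; exact: (rpredZ (s := W)).
Qed.

HB.instance Definition _ :=
  GRing.isSubmodClosed.Build R (submod U) restr_pred restr_pred_closed.

(* The module U/W when W is contained in U (in general U / (U \cap W)). *)
Definition subquot : lmodType R := quot_mod restr_pred.

End SubQuotient.

Section KernelImage.
Variables (R : comNzRingType) (V V' : lmodType R) (f : {linear V -> V'}).

Definition zero_submod : {pred V} := fun x => x == 0.

Fact zero_submod_closed : submod_closed zero_submod.
Proof.
split=> [|a u v]; rewrite !unfold_in //=.
by move=> /eqP-> /eqP->; rewrite scaler0 addr0.
Qed.

HB.instance Definition _ :=
  GRing.isSubmodClosed.Build R V zero_submod zero_submod_closed.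

Definition ker_submod : {pred V} := fun x => f x == 0.

Fact ker_submod_closed : submod_closed ker_submod.
Proof.
split=> [|a u v]; rewrite !unfold_in ?linear0 //.
by rewrite linearP => /eqP-> /eqP->; rewrite scaler0 addr0.
Qed.

HB.instance Definition _ :=
  GRing.isSubmodClosed.Build R V ker_submod ker_submod_closed.

Definition im_submod : {pred V'} := fun y => `[< exists x, f x = y >].

Fact im_submod_closed : submod_closed im_submod.
Proof.
split=> [|a u v]; rewrite !unfold_in; first by apply/asboolP; exists 0; rewrite linear0.
move=> /asboolP[x <-] /asboolP[y <-]; apply/asboolP.
by exists (a *: x + y); rewrite linearP.
Qed.

HB.instance Definition _ :=
  GRing.isSubmodClosed.Build R V' im_submod im_submod_closed.

End KernelImage.

Arguments zero_submod {R} V.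

Section Cohomology.
Variables (R : comNzRingType) (C : nat -> lmodType R).
Variable d : forall i, {linear C i -> C i.+1}.

Definition coboundaries (i : nat) : submodClosed (C i) :=
  match i return submodClosed (C i) with
  | 0 => zero_submod (C 0)
  | j.+1 => im_submod (d j)
  end.

Definition cohomology (i : nat) : lmodType R :=
  subquot (ker_submod (d i)) (coboundaries i).

End Cohomology.

Section Torsion.
Variables (R : comNzRingType) (I : {pred R}).

(* I^0 = R, and I^(n+1) consists of the finite sums of products of an element
   of I by an element of I^n. *)
Fixpoint ideal_exp (n : nat) : R -> Prop :=
  if n is n'.+1 then
    fun a => exists s : seq (R * R),
      (forall p, p \in s -> p.1 \in I /\ ideal_exp n' p.2) /\
      a = \sum_(p <- s) p.1 * p.2
  else fun=> True.

Lemma ideal_exp_anti (n k : nat) (a : R) :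
  (n <= k)%N -> ideal_exp k a -> ideal_exp n a.
Proof.
elim: n k a => [|n IHn] [|k] a //= le_nk [s [sI ->]]; exists s; split=> // p ps.
by have [pI pk] := sI p ps; split=> //; apply: IHn pk.
Qed.

Variable V : lmodType R.

Definition torsion : {pred V} :=
  fun x => `[< exists n, forall a, ideal_exp n a -> a *: x = 0 >].

Fact torsion_closed : submod_closed torsion.
Proof.
split=> [|c u v]; rewrite !unfold_in.
  by apply/asboolP; exists 0 => a _; rewrite scaler0.
move=> /asboolP[n nu] /asboolP[k kv]; apply/asboolP; exists (maxn n k) => a Ia.
rewrite scalerDr scalerA mulrC -scalerA nu ?kv ?scaler0 ?addr0 //.
  by apply: ideal_exp_anti Ia; apply: leq_maxr.
by apply: ideal_exp_anti Ia; apply: leq_maxl.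
Qed.

HB.instance Definition _ :=
  GRing.isSubmodClosed.Build R V torsion torsion_closed.

End Torsion.

Arguments torsion {R} I V.

Definition Gamma (R : comNzRingType) (I : {pred R}) (V : lmodType R) :
  lmodType R := submod (torsion I V).

Section GammaMap.
Variables (R : comNzRingType) (I : {pred R}) (V V' : lmodType R).
Variable f : {linear V -> V'}.

Fact Gamma_map_subproof (x : Gamma I V) : f (val x) \in torsion I V'.
Proof.
have /asboolP[n nx] := submod_valP x.
by apply/asboolP; exists n => a /nx; rewrite -linearZ => ->; rewrite linear0.
Qed.

Definition Gamma_map (x : Gamma I V) : Gamma I V' :=
  Submod (Gamma_map_subproof x).

Fact Gamma_map_is_linear : linear Gamma_map.
Proof. by move=> a x y; apply: val_inj; rewrite /= linearP. Qed.

HB.instance Definition _ := GRing.isLinear.Build R (Gamma I V) (Gamma I V') _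
  Gamma_map Gamma_map_is_linear.

End GammaMap.

Arguments Gamma_map {R} I {V V'} f.

Definition injective_module (R : comNzRingType) (E : lmodType R) : Prop :=
  forall (A B : lmodType R) (f : {linear A -> B}) (g : {linear A -> E}),
    injective f -> exists h : {linear B -> E}, forall a, h (f a) = g a.

(* 0 -> M -> E^0 -> E^1 -> ... exact with all E^i injective. *)
Record injective_resolution (R : comNzRingType) (M : lmodType R) := {
  res_obj : nat -> lmodType R;
  res_diff : forall i, {linear res_obj i -> res_obj i.+1};
  res_aug : {linear M -> res_obj 0};
  res_injective : forall i, injective_module (res_obj i);
  res_aug_inj : injective res_aug;
  res_exact0 : forall x, res_diff 0 x = 0 <-> exists y, res_aug y = x;
  res_exact : forall i x,
    res_diff i.+1 x = 0 <-> exists y, res_diff i y = x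
}.

(* H^i_I(M), the i-th right derived functor of Gamma_I at M, computed from an
   injective resolution of M. *)
Definition local_cohomology (R : comNzRingType) (I : {pred R}) (M : lmodType R)
    (E : injective_resolution M) (i : nat) : lmodType R :=
  cohomology (fun j => Gamma_map I (res_diff E j)) i.

Definition fin_gen (R : comNzRingType) (V : lmodType R) (S : {pred V}) : Prop :=
  exists n (s : 'I_n -> V), (forall i, s i \in S) /\
    forall x, x \in S -> exists c : 'I_n -> R, x = \sum_(i < n) c i *: s i.

Definition noetherian (R : comNzRingType) : Prop :=
  forall J : submodClosed R^o, fin_gen J.

Definition maximal_ideal (R : comNzRingType) (J : idealr R) : Prop :=
  forall K : idealr R, {subset J <= K} -> {subset K <= J}.

Definition local_ring (R : comNzRingType) (m : idealr R) : Prop :=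
  maximal_ideal m /\ forall J : idealr R, maximal_ideal J -> J =i m.

(* p_0 < p_1 < ... < p_n, a chain of primes of R / Ann(M), that is, of primes of
   R containing Ann(M); the values p_i for i > n are irrelevant. *)
Definition prime_chain (R : comNzRingType) (M : lmodType R) (n : nat)
    (p : nat -> prime_idealr R) : Prop :=
  (forall i, (i <= n)%N ->
     forall a : R, (forall x : M, a *: x = 0) -> a \in p i) /\
  (forall i, (i < n)%N ->
     {subset p i <= p i.+1} /\ ~ {subset p i.+1 <= p i}).

Definition krull_dim (R : comNzRingType) (M : lmodType R) (d : nat) : Prop :=
  (exists p, prime_chain M d p) /\
  forall n p, prime_chain M n p -> (n <= d)%N.

Definition chain_condition (R : comNzRingType) (P : lmodType R -> Prop)
    (X : lmodType R) : Prop :=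
  forall Y : nat -> submodClosed X, (forall k, {subset Y k <= Y k.+1}) ->
    exists n, forall k, (n <= k)%N -> P (subquot (Y k.+1) (Y k)).

(* N.dim(X) < r.  The case r = s + 1 reads: N.dim(X) < s or N.dim(X) = s. *)
Fixpoint Ndim_lt (R : comNzRingType) (r : nat) (X : lmodType R) : Prop :=
  if r is s.+1 then
    Ndim_lt s X \/ (~ Ndim_lt s X /\ chain_condition (Ndim_lt s) X)
  else forall x : X, x = 0.

(* N.dim(X) = r.  This is a relation, as N.dim(X) may be undefined. *)
Definition Ndim (R : comNzRingType) (X : lmodType R) (r : int) : Prop :=
  match r with
  | Posz s => ~ Ndim_lt s X /\ chain_condition (Ndim_lt s) X
  | Negz 0 => forall x : X, x = 0
  | Negz _.+1 => False
  end.

(* Main.v *)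
Require Import Defs.
From HB Require Import structures.
From mathcomp Require Import all_boot all_order all_algebra.
From mathcomp Require Import boolp classical_sets.

Set Implicit Arguments.
Unset Strict Implicit.
Unset Printing Implicit Defensive.

Import GRing.Theory.
Local Open Scope ring_scope.

(** Why the bound holds.  Write H^i(N) for the local cohomology of N with respect
    to I.  By induction on e, every finitely generated N with dim N < e satisfies
    two properties: H^i(N) = 0 for i >= e, and H^(e-1)(N) is Artinian with
    N.dim < e.  The theorem is the case e = d + 1, i = d of [cohNd_fin_gen].

    Zero modules and Artinian modules with N.dim < e are stable under submodules,
    quotients and extensions, so by devissage one may take N = R/P with P prime
    ([cohNd_cyclic]).  If P contains I, then N is I-torsion, so H^i(N) = 0 for i > 0
    ([cohNd_tors]), and H^0(N), a submodule of N, matters only when e = 1, where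
    R/P is a field.  Otherwise some x in I outside P is regular on N and
    dim N/xN < e - 1.  In the exact sequence
      H^(i-1)(N/xN) -> H^i(N) -> H^i(N)
    whose second map is multiplication by x, induction controls the first term,
    hence the kernel of x on H^i(N), on which x is locally nilpotent.  If this
    kernel is zero then so is H^i(N), and if it is Artinian with N.dim < r then H^i(N)
    is Artinian with N.dim < r + 1 ([ArtNd_tors]).  Each step raises the
    cohomological degree by one together with the dimension, which gives the bound.

    Subquotients are treated as intervals between two submodules of a fixed
    module, compared through linear relations ([dom]); this avoids all quotient
    modules in the study of N.dim and of cohomology.

    The homological input is proved for all resolutions at once, without comparing
    them.  A complex of injectives is said to resolve M if its only cohomology is M,
    possibly in positive degree, and a property of H^i(M) is required of every such
    complex.  The long exact sequences then reduce to the observation that the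
    mapping cone of a chain map E -> F between resolutions is again a resolution, of
    the kernel or of the cokernel of the induced map.  Two further facts are used.
    There are enough injective modules, namely the modules of additive maps from R
    to powers of Q/Z ([injective_hull]), so that every surjection M -> N lifts to
    resolutions.  The torsion submodule of an injective module is a direct summand
    ([tors_retraction]), by Baer's criterion and a weak Artin-Rees lemma; it follows
    that passing to torsion submodules does not change the cohomology of a complex
    of injectives whose cohomology is torsion ([tors_lift]). *)

(** * Intervals of submodules *)

Section Intervals.
Variable R : comNzRingType.

Definition submodP (V : lmodType R) (U : V -> Prop) : Prop :=
  U 0 /\ forall a u v, U u -> U v -> U (a *: u + v).

Section SubmodP.
Variables (V : lmodType R) (U : V -> Prop).
Hypothesis sU : submodP U.

Lemma submodP0 : U 0. Proof. by case: sU. Qed.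

Lemma submodPZ a u : U u -> U (a *: u).
Proof. by move=> Uu; rewrite -[_ *: _]addr0; apply: sU.2 => //; exact: sU.1. Qed.

Lemma submodPD u v : U u -> U v -> U (u + v).
Proof. by move=> Uu Uv; rewrite -[u]scale1r; apply: sU.2. Qed.

Lemma submodPN u : U u -> U (- u).
Proof. by move=> Uu; rewrite -scaleN1r; apply: submodPZ. Qed.

Lemma submodPB u v : U u -> U v -> U (u - v).
Proof. by move=> Uu Uv; apply: submodPD => //; apply: submodPN. Qed.

Lemma submodPBl u v : U (u - v) -> U v -> U u.
Proof. by move=> Uuv Uv; rewrite -(subrK v u); apply: submodPD. Qed.

End SubmodP.

(** A submodule of V x V': a partial, possibly multivalued, homomorphism.  Such
    relations replace maps between subquotients, which would require quotient
    modules and choices of representatives. *)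
Definition lrel (V V' : lmodType R) (rho : V -> V' -> Prop) : Prop :=
  @submodP (V * V')%type (fun p => rho p.1 p.2).

Section Lrel.
Variables (V V' : lmodType R) (rho : V -> V' -> Prop).
Hypothesis sr : lrel rho.

Lemma lrel0 : rho 0 0. Proof. exact: (submodP0 sr). Qed.

Lemma lrelP a v x v' x' :
  rho v x -> rho v' x' -> rho (a *: v + v') (a *: x + x').
Proof. exact: (sr.2 a (v, x) (v', x')). Qed.

Lemma lrelB v x v' x' : rho v x -> rho v' x' -> rho (v - v') (x - x').
Proof. exact: (@submodPB _ _ sr (v, x) (v', x')). Qed.

Lemma lrelZ a v x : rho v x -> rho (a *: v) (a *: x).
Proof. exact: (@submodPZ _ _ sr a (v, x)). Qed.

End Lrel.

Lemma lrelI (V V' : lmodType R) (rho : V -> V' -> Prop) :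
  rho 0 0 ->
  (forall a v x v' x', rho v x -> rho v' x' ->
     rho (a *: v + v') (a *: x + x')) -> lrel rho.
Proof. by move=> r0 rD; split=> // a [v x] [v' x']; apply: rD. Qed.

Section OneModule.
Variable V : lmodType R.
Implicit Types U W T : V -> Prop.

Definition zeroP : V -> Prop := fun x => x = 0.
Definition fullP : V -> Prop := fun=> True.
Definition addP U W : V -> Prop := fun x => exists2 u, U u & W (x - u).
Definition capP U W : V -> Prop := fun x => U x /\ W x.

Lemma submodP_zero : submodP zeroP.
Proof. by split=> // a u v -> ->; rewrite /zeroP scaler0 addr0. Qed.

Lemma submodP_full : submodP fullP.
Proof. by []. Qed.

Lemma submodP_add U W : submodP U -> submodP W -> submodP (addP U W).
Proof.
move=> sU sW; split; first by exists 0; rewrite ?subr0; [exact: sU.1|exact: sW.1].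
move=> a x y [u Uu Wu] [v Uv Wv]; exists (a *: u + v); first exact: sU.2.
by rewrite opprD addrACA -scalerBr; apply: sW.2.
Qed.

Lemma submodP_cap U W : submodP U -> submodP W -> submodP (capP U W).
Proof.
move=> sU sW; split; first by split; [exact: sU.1|exact: sW.1].
by move=> a x y [Ux Wx] [Uy Wy]; split; [exact: sU.2|exact: sW.2].
Qed.

Lemma addPl U W x : submodP W -> U x -> addP U W x.
Proof. by move=> sW Ux; exists x => //; rewrite subrr; exact: sW.1. Qed.

Lemma addPr U W x : submodP U -> W x -> addP U W x.
Proof. by move=> sU Wx; exists 0; [exact: sU.1|rewrite subr0]. Qed.

Definition itv W U := [/\ submodP W, submodP U & forall x, W x -> U x].

Definition between W U (Y : nat -> V -> Prop) :=
  [/\ forall k, submodP (Y k), forall k x, W x -> Y k x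
    & forall k x, Y k x -> U x].

Definition Art W U := forall Y, between W U Y ->
  (forall k x, Y k.+1 x -> Y k x) ->
  exists n, forall k, (n <= k)%N -> forall x, Y n x -> Y k x.

(** N.dim(U/W) < r, with the chains of submodules of U/W replaced by chains
    between W and U.  Subquotients of U/W are then again intervals in V. *)
Fixpoint Nd (r : nat) W U : Prop :=
  if r is s.+1 then
    forall Y, between W U Y -> (forall k x, Y k x -> Y k.+1 x) ->
    exists n, forall k, (n <= k)%N -> Nd s (Y k) (Y k.+1)
  else forall x, U x -> W x.

Definition ArtNd r W U := Art W U /\ Nd r W U.

Lemma NdS r W U : Nd r W U -> Nd r.+1 W U.
Proof.
elim: r W U => [|r IHr] W U /= H Y bY cY; last first.
  by have [n Hn] := H Y bY cY; exists n => k /Hn/IHr.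
exists 0%N => k _ x /=; case: bY => _ WY YU.
by move=> /YU/H/WY.
Qed.

Lemma Nd0 r W U : (forall x, U x -> W x) -> Nd r W U.
Proof. by move=> H; elim: r => [//|r]; apply: NdS. Qed.

Lemma Art0 W U : (forall x, U x -> W x) -> Art W U.
Proof.
by move=> H Y [_ WY YU] _; exists 0%N => k _ x /YU/H/WY.
Qed.

Lemma ArtNd0 r W U : (forall x, U x -> W x) -> ArtNd r W U.
Proof. by move=> H; split; [exact: Art0|exact: Nd0]. Qed.

Lemma chain_le (Y : nat -> V -> Prop) : (forall k x, Y k x -> Y k.+1 x) ->
  forall k n, (k <= n)%N -> forall x, Y k x -> Y n x.
Proof.
move=> cY k n /subnKC <- x Yx; elim: (n - k)%N => [|j IHj]; first by rewrite addn0.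
by rewrite addnS; apply: cY.
Qed.

Lemma chain_ge (Y : nat -> V -> Prop) : (forall k x, Y k.+1 x -> Y k x) ->
  forall k n, (k <= n)%N -> forall x, Y n x -> Y k x.
Proof.
move=> cY k n /subnKC <- x; elim: (n - k)%N => [|j IHj]; first by rewrite addn0.
by rewrite addnS => /cY.
Qed.

End OneModule.

Arguments zeroP {V}.
Arguments fullP {V}.

(** U'/W' is a subquotient of U/W: the relation rho induces a homomorphism from
    a submodule of U/W onto U'/W'. *)
Definition dom (V V' : lmodType R) (W U : V -> Prop) (W' U' : V' -> Prop) :=
  exists rho, [/\ lrel rho, forall x, U' x -> exists2 v, U v & rho v x
    & forall v x, W v -> rho v x -> U' x -> W' x].

Section Domination.
Variables (V V' : lmodType R).

(** Adding W x 0 to the relation makes the preimages of submodules contain W. *)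
Lemma dom_saturate (W U : V -> Prop) (W' U' : V' -> Prop) :
  itv W U -> itv W' U' -> dom W U W' U' ->
  exists rho, [/\ lrel rho, forall x, U' x -> exists2 v, U v & rho v x,
    forall v x, W v -> rho v x -> U' x -> W' x & forall v, W v -> rho v 0].
Proof.
move=> [sW sU WU] _ [rho [sr ronto rW]].
exists (fun v x => exists2 w, W w & rho (v - w) x); split.
- apply: lrelI; first by exists 0; [exact: sW.1|rewrite subr0; exact: lrel0 sr].
  move=> a v x v' x' [w Ww rw] [w' Ww' rw']; exists (a *: w + w'); first exact: sW.2.
  by rewrite opprD addrACA -scalerBr; apply: lrelP.
- move=> x /ronto[v Uv rv]; exists v => //; exists 0; first exact: sW.1.
  by rewrite subr0.
- move=> v x Wv [w Ww rw] U'x; apply: rW rw U'x.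
  exact: submodPB.
- by move=> v Wv; exists v => //; rewrite subrr; exact: lrel0 sr.
Qed.

Variables (rho : V -> V' -> Prop) (sr : lrel rho).

Definition preim (U : V -> Prop) (Y : V' -> Prop) : V -> Prop :=
  fun v => U v /\ exists2 x, Y x & rho v x.

Lemma submodP_preim U Y : submodP U -> submodP Y -> submodP (preim U Y).
Proof.
move=> sU sY; split.
  by split; [exact: sU.1|exists 0; [exact: sY.1|exact: lrel0 sr]].
move=> a u v [Uu [x Yx rx]] [Uv [y Yy ry]]; split; first exact: sU.2.
by exists (a *: x + y); [exact: sY.2|exact: lrelP].
Qed.

Lemma between_preim W U W' U' Y : itv W U -> (forall v, W v -> rho v 0) ->
  between W' U' Y -> between W U (fun k => preim U (Y k)).
Proof.
move=> [sW sU WU] rW [sY WY YU]; split.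
- by move=> k; apply: submodP_preim.
- move=> k x Wx; split; first exact: WU.
  by exists 0; [exact: (sY k).1|exact: rW].
- by move=> k x [].
Qed.

Lemma preim_reflect W U W' U' Y v x : itv W U ->
  (forall v x, W v -> rho v x -> U' x -> W' x) ->
  submodP U' -> submodP Y -> (forall x, W' x -> Y x) -> (forall x, Y x -> U' x) ->
  preim U Y v -> rho v x -> U' x -> Y x.
Proof.
move=> [sW _ _] rW sU' sY WY YU [Uv [y Yy ry]] rx U'x.
apply: (submodPBl sY) (Yy); apply: WY; apply: (rW 0); first exact: sW.1.
  by rewrite -(subrr v); apply: lrelB.
by apply: submodPB => //; exact: YU.
Qed.

End Domination.

(** Pulling a chain back along the relation gives a chain whose steps are related
    to the original ones by the same relation, so that induction on r applies. *)
Lemma Nd_dom r (V V' : lmodType R) (W U : V -> Prop) (W' U' : V' -> Prop) :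
  itv W U -> itv W' U' -> dom W U W' U' -> Nd r W U -> Nd r W' U'.
Proof.
elim: r W U W' U' => [|r IHr] W U W' U' iU iU'
    /(dom_saturate iU iU')[rho [sr ronto rW rW0]] H.
  by move=> x U'x; have [v /H Wv rv] := ronto x U'x; apply: rW rv U'x.
move=> Y bY cY; have [sY WY YU] := bY.
have bZ := between_preim sr iU rW0 bY; have [sZ _ _] := bZ.
have cZ k v : preim rho U (Y k) v -> preim rho U (Y k.+1) v.
  by move=> [Uv [x /cY ? ?]]; split=> //; exists x.
have [n Hn] := H _ bZ cZ.
exists n => k /Hn; apply: IHr; [by split; [exact: sZ|exact: sZ|exact: cZ]|by split=> //; exact: cY|exists rho; split=> //].
  by move=> x Yx; have [v Uv rv] := ronto x (YU _ _ Yx); exists v => //; split=> //; exists x.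
move=> v x vY rv Yx; apply: (preim_reflect sr iU rW _ _ _ _ vY rv) => //.
- by case: iU'.
- exact: WY.
- exact: YU.
- exact: YU Yx.
Qed.

Lemma Art_dom (V V' : lmodType R) (W U : V -> Prop) (W' U' : V' -> Prop) :
  itv W U -> itv W' U' -> dom W U W' U' -> Art W U -> Art W' U'.
Proof.
move=> iU iU' /(dom_saturate iU iU')[rho [sr ronto rW rW0]] H Y bY cY.
have [sY WY YU] := bY; have bZ := between_preim sr iU rW0 bY.
have [|n Hn] := H _ bZ; first by move=> k v [Uv [x /cY ? ?]]; split=> //; exists x.
exists n => k /Hn{}Hn x Ynx; have [v Uv rv] := ronto x (YU _ _ Ynx).
apply: (preim_reflect sr iU rW _ _ _ _ (Hn v _) rv) => //.
- by case: iU'.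
- exact: WY.
- exact: YU.
- by split=> //; exists x.
- exact: YU Ynx.
Qed.

Lemma ArtNd_dom r (V V' : lmodType R) (W U : V -> Prop) (W' U' : V' -> Prop) :
  itv W U -> itv W' U' -> dom W U W' U' -> ArtNd r W U -> ArtNd r W' U'.
Proof.
by move=> iU iU' D [A N]; split; [apply: Art_dom D A|apply: Nd_dom D N].
Qed.

Section Extension.
Variable V : lmodType R.
Implicit Types U W T : V -> Prop.

(** The inclusion of U' in U embeds U'/(U' cap W) in U/W. *)
Lemma dom_incl W U W' U' : (forall x, U' x -> U x) ->
  (forall x, W x -> U' x -> W' x) -> dom W U W' U'.
Proof.
move=> U'U WW'; exists eq; split.
- by apply: lrelI => // a v x v' x' -> ->.
- by move=> x /U'U; exists x.
- by move=> v x Wv <-; apply: WW'.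
Qed.

Lemma between_cap W U T Y : itv W T -> between W U Y ->
  between W T (fun k => capP (Y k) T).
Proof.
move=> [sW sT WT] [sY WY YU]; split.
- by move=> k; exact: submodP_cap.
- by move=> k x Wx; split; [exact: WY|exact: WT].
- by move=> k x [].
Qed.

Lemma between_add W U T Y : itv T U -> between W U Y ->
  between T U (fun k => addP (Y k) T).
Proof.
move=> [sT sU TU] [sY WY YU]; split.
- by move=> k; exact: submodP_add.
- by move=> k x Tx; apply: addPr.
- by move=> k x [y /YU Uy /TU Uxy]; apply: (submodPBl sU) Uxy Uy.
Qed.

(** The step from Y_k to Y_(k+1) is cut at Y_k + (Y_(k+1) cap T); its two pieces
    are steps of the chains induced in T/W and in U/T. *)
Lemma Nd_ext r W T U : itv W T -> itv T U -> Nd r W T -> Nd r T U -> Nd r W U.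
Proof.
elim: r W T U => [|r IHr] W T U iT iU HT HU.
  by move=> x /HU/HT.
move=> Y bY cY; have [sY WY YU] := bY.
have [sW sT WT] := iT; have [_ sU TU] := iU.
have bC := between_cap iT bY; have bA := between_add iU bY.
have [|n Hn] := HT _ bC; first by move=> k x [/cY].
have [|n' Hn'] := HU _ bA; first by move=> k x [y /cY Yy Ty]; exists y.
exists (maxn n n') => k; rewrite geq_max => /andP[/Hn {}Hn /Hn' {}Hn'].
pose mid := addP (Y k) (capP (Y k.+1) T).
have sC j : submodP (capP (Y j) T) by apply: submodP_cap.
have sA j : submodP (addP (Y j) T) by apply: submodP_add.
have smid : submodP mid by apply: submodP_add.
have i1 : itv (Y k) mid by split=> // x Yx; apply: addPl.
have i2 : itv mid (Y k.+1).
  by split=> // x [y /cY Yy [Yxy _]]; apply: (submodPBl (sY _)) Yxy Yy.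
apply: (IHr _ mid) => //.
- apply: Nd_dom Hn => //; first by split=> // x [/cY].
  exists (fun v x => Y k (x - v)); split.
  + apply: lrelI => [|a v x v' x' H H']; first by rewrite subrr; exact: (sY k).1.
    by rewrite opprD addrACA -scalerBr; apply: (sY k).2.
  + move=> x [y Yy [Yxy Txy]]; exists (x - y); first by split.
    by rewrite opprB addrC subrK.
  + by move=> v x [Yv _] Yxv _; apply: (submodPBl (sY k)) Yxv Yv.
- apply: Nd_dom Hn' => //; first by split=> // x [y /cY Yy Ty]; exists y.
  apply: dom_incl => [x Yx|x [y Yy Txy] Yx]; first exact: addPl.
  by exists y => //; split=> //; apply: submodPB => //; exact: cY.
Qed.

(** If Y_k and Y_n have the same trace on T and the same sum with T, the modular
    law makes them equal. *)
Lemma Art_ext W T U : itv W T -> itv T U -> Art W T -> Art T U -> Art W U.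
Proof.
move=> iT iU HT HU Y bY cY; have [sY WY YU] := bY.
have bC := between_cap iT bY; have bA := between_add iU bY.
have [|n Hn] := HT _ bC; first by move=> k x [/cY].
have [|n' Hn'] := HU _ bA; first by move=> k x [y /cY Yy Ty]; exists y.
exists (maxn n n') => k; rewrite geq_max => /andP[le_nk le_n'k] x Yx.
have Ymx := chain_ge cY (leq_maxl n n') Yx.
have Ym'x := chain_ge cY (leq_maxr n n') Yx.
have [|y Yy Txy] := Hn' k le_n'k x; first by apply: addPl => //; case: iT.
suff [Yxy _] : capP (Y k) T (x - y) by apply: (submodPBl (sY k)) Yxy Yy.
apply: Hn => //; split=> //; apply: submodPB => //.
exact: chain_ge Yy.
Qed.

Lemma ArtNd_ext r W T U :
  itv W T -> itv T U -> ArtNd r W T -> ArtNd r T U -> ArtNd r W U.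
Proof.
by move=> iT iU [A N] [A' N']; split; [apply: Art_ext A A'|apply: Nd_ext N N'].
Qed.

Lemma ArtNd_le r r' W U : (r <= r')%N -> ArtNd r W U -> ArtNd r' W U.
Proof.
move=> /subnKC <- [A N]; split=> //; elim: (r' - r)%N => [|j IHj]; first by rewrite addn0.
by rewrite addnS; apply: NdS.
Qed.

End Extension.

(** * Modules on which a ring element is locally nilpotent *)

Section TorsionStep.
Variables (V : lmodType R) (a : R).
Implicit Types W U Y : V -> Prop.

Definition ann_exp W U k : V -> Prop := fun u => U u /\ W (a ^+ k *: u).

(** For Y between W and U, the elements a^k u with u in Y and a^(k+1) u in W form
    a submodule of the kernel of a on U/W.  These submodules decrease with k, and
    when every element of U/W is killed by a power of a they detect whether an
    inclusion Y <= Y' is an equality. *)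
Definition layer W Y k : V -> Prop := fun v =>
  exists u, [/\ Y u, W (a ^+ k.+1 *: u) & W (v - a ^+ k *: u)].

Lemma submodP_ann_exp W U k : submodP W -> submodP U -> submodP (ann_exp W U k).
Proof.
move=> sW sU; split; first by split; rewrite ?scaler0; [exact: sU.1|exact: sW.1].
move=> b u v [Uu Wu] [Uv Wv]; split; first exact: sU.2.
by rewrite scalerDr scalerA mulrC -scalerA; apply: sW.2.
Qed.

Lemma submodP_layer W Y k : submodP W -> submodP Y -> submodP (layer W Y k).
Proof.
move=> sW sY; split.
  by exists 0; rewrite !scaler0 subr0; split; [exact: sY.1|exact: sW.1|exact: sW.1].
move=> b v v' [u [Yu Wu Wvu]] [u' [Yu' Wu' Wvu']]; exists (b *: u + u'); split.
- exact: sY.2.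
- by rewrite scalerDr scalerA mulrC -scalerA; apply: sW.2.
- rewrite scalerDr scalerA mulrC -scalerA opprD addrACA -scalerBr.
  exact: sW.2.
Qed.

Lemma layer_sub W Y k v : submodP W -> W v -> submodP Y -> layer W Y k v.
Proof.
move=> sW Wv sY; exists 0; rewrite !scaler0 subr0; split=> //.
  exact: sY.1.
exact: sW.1.
Qed.

Lemma layer_ann W U Y k v : itv W U -> (forall x, Y x -> U x) ->
  layer W Y k v -> ann_exp W U 1 v.
Proof.
move=> [sW sU WU] YU [u [/YU Uu Wu Wvu]]; split.
  apply: (submodPBl sU (WU _ Wvu)); exact: submodPZ.
rewrite expr1; apply: (submodPBl sW (v := a *: (a ^+ k *: u))); last first.
  by rewrite scalerA -exprS.
by rewrite -scalerBr; apply: submodPZ.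
Qed.

Lemma layer_anti W Y k n v : submodP W -> submodP Y -> (k <= n)%N ->
  layer W Y n v -> layer W Y k v.
Proof.
move=> sW sY /subnKC <-; elim: (n - k)%N v => [|j IHj] v; first by rewrite addn0.
rewrite addnS => -[u [Yu Wu Wvu]]; apply: IHj; exists (a *: u).
by rewrite !scalerA -!exprSr; split=> //; exact: submodPZ.
Qed.

Lemma layer_mono W Y Y' k v : (forall x, Y x -> Y' x) ->
  layer W Y k v -> layer W Y' k v.
Proof. by move=> YY' [u [/YY' ? ? ?]]; exists u. Qed.

Lemma between_layer W U (Y : nat -> V -> Prop) (f g : nat -> nat) :
  itv W U -> between W U Y ->
  between W (ann_exp W U 1) (fun n => layer W (Y (f n)) (g n)).
Proof.
move=> iU [sY WY YU]; have [sW sU WU] := iU; split.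
- by move=> n; apply: submodP_layer.
- by move=> n x Wx; apply: layer_sub.
- by move=> n x; apply: layer_ann => //; exact: YU.
Qed.

Lemma itv_ann_exp W U k : itv W U -> itv W (ann_exp W U k).
Proof.
move=> [sW sU WU]; split=> //; first exact: submodP_ann_exp.
by move=> x Wx; split; [exact: WU|exact: submodPZ].
Qed.

(** Multiplication by a^k embeds the k-th step of the filtration by the kernels of
    the powers of a in the kernel of a. *)
Lemma ArtNd_ann_exp r W U k : itv W U ->
  ArtNd r W (ann_exp W U 1) -> ArtNd r W (ann_exp W U k).
Proof.
move=> iU H; have [sW sU WU] := iU; elim: k => [|k IHk].
  by apply: ArtNd0 => x []; rewrite expr0 scale1r.
have i1 := itv_ann_exp 1 iU; have iX := itv_ann_exp k iU; have iS := itv_ann_exp k.+1 iU.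
have iXS : itv (ann_exp W U k) (ann_exp W U k.+1).
  split; [by case: iX|by case: iS|move=> x [Ux Wx]; split=> //].
  by rewrite exprS -scalerA; apply: submodPZ.
apply: (ArtNd_ext (T := ann_exp W U k)) => //.
apply: ArtNd_dom H => //; exists (fun v x => W (v - a ^+ k *: x)); split.
- apply: lrelI => [|b v x v' x' H H']; first by rewrite scaler0 subr0; exact: sW.1.
  rewrite scalerDr scalerA mulrC -scalerA opprD addrACA -scalerBr.
  exact: sW.2.
- move=> x [Ux Wx]; exists (a ^+ k *: x); last by rewrite subrr; exact: sW.1.
  by split; [exact: submodPZ|rewrite expr1 scalerA -exprS].
- move=> v x Wv Wvx [Ux _]; split=> //.
  rewrite -[_ *: _](subrK v) -opprB; apply: submodPD => //; exact: submodPN.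
Qed.

(** The layers of a descending chain form a doubly descending family in an
    Artinian module.  The diagonal stabilizes at some n0, which leaves finitely many
    layers k < n0 to stabilize separately; a chain all of whose layers are constant
    is constant. *)
Lemma Art_tors W U : itv W U -> (forall u, U u -> exists k, W (a ^+ k *: u)) ->
  Art W (ann_exp W U 1) -> Art W U.
Proof.
move=> iU tors H Y bY cY; have [sW sU WU] := iU; have [sY WY YU] := bY.
have [n0 Hn0] := H _ (between_layer id id iU bY) (fun n v Z =>
  layer_anti sW (sY n) (leqnSn n) (layer_mono (cY n) Z)).
have [N HN] : exists N, forall k n, (N <= n)%N -> forall v,
    layer W (Y N) k v -> layer W (Y n) k v.
  have [N HN] : exists N, forall k n, (k < n0)%N -> (N <= n)%N -> forall v,
      layer W (Y N) k v -> layer W (Y n) k v.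
    elim: n0 {Hn0} => [|b [N HN]]; first by exists 0%N.
    have [N' HN'] := H _ (between_layer id (fun=> b) iU bY) (fun n v Z =>
      layer_mono (cY n) Z).
    exists (maxn N N') => k n; rewrite ltnS leq_eqVlt geq_max.
    case/orP=> [/eqP->|lt_kb] /andP[le_Nn le_N'n] v Zv.
      apply: HN' => //; apply: layer_mono Zv.
      exact: (chain_ge cY (leq_maxr N N')).
    apply: HN => //; apply: layer_mono Zv.
    exact: (chain_ge cY (leq_maxl N N')).
  exists (maxn n0 N) => k n; rewrite geq_max => /andP[le_n0n le_Nn] v Zv.
  have [lt_k|ge_k] := ltnP k n0.
    apply: HN => //; apply: layer_mono Zv; exact: (chain_ge cY (leq_maxr _ _)).
  apply: (layer_anti sW (sY n) (leq_maxr n k)).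
  apply: (layer_mono (chain_ge cY (leq_maxl n k))).
  apply: (Hn0 (maxn n k)) => /=; first by rewrite leq_max le_n0n.
  apply: (layer_anti sW (sY n0) ge_k); apply: layer_mono Zv.
  exact: (chain_ge cY (leq_maxl n0 N)).
exists N => n le_Nn x YNx; have [j Wj] := tors x (YU _ _ YNx).
elim: j x YNx Wj => [|j IHj] x YNx Wj.
  by apply: WY; move: Wj; rewrite expr0 scale1r.
have [|u [Yu Wu Wxu]] := HN j n le_Nn (a ^+ j *: x).
  by exists x; rewrite subrr; split=> //; exact: sW.1.
suff Yxu : Y n (x - u) by apply: (submodPBl (sY n)) Yxu Yu.
apply: IHj; last by rewrite scalerBr.
by apply: submodPB => //; exact: chain_ge Yu.
Qed.

Lemma tors_zero W U : itv W U -> (forall u, U u -> exists k, W (a ^+ k *: u)) ->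
  (forall u, U u -> W (a *: u) -> W u) -> forall u, U u -> W u.
Proof.
move=> [sW sU WU] tors H u Uu; have [k] := tors u Uu.
elim: k => [|k IHk]; rewrite ?expr0 ?scale1r // exprS -scalerA => /H Wk.
by apply/IHk/Wk; exact: submodPZ.
Qed.

(** Let Y be an ascending chain, and Z_n the limit of the layers of Y_n.  The Z_n
    form a chain in the kernel of a, so for large n the induction hypothesis will
    apply to Z_(n+1)/Z_n.  Fix such an n and a K from which on the layers of Y_n and
    Y_(n+1) are constant, and let F k be the sum of Y_n and of the part of Y_(n+1)
    killed by a^k.  Then F K / Y_n is a quotient of a module killed by a^K, while
    the kernel of a on Y_(n+1) / F K is a subquotient of Z_(n+1)/Z_n, so that
    Y_(n+1) / F K is bounded by induction. *)
Lemma Nd_tors r W U : itv W U -> (forall u, U u -> exists k, W (a ^+ k *: u)) ->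
  ArtNd r W (ann_exp W U 1) -> Nd r.+1 W U.
Proof.
elim: r W U => [|r IHr] W U iU tors AH.
  apply: Nd0; apply: tors_zero => // u Uu Wu.
  by apply: (AH.2 u); split=> //; rewrite expr1.
have [A H] := AH; have [sW sU WU] := iU => Y bY cY; have [sY WY YU] := bY.
pose Z n v := forall k, layer W (Y n) k v.
have bZ : between W (ann_exp W U 1) Z.
  split.
  - move=> n; split=> [k|b u v Hu Hv k].
      exact: (submodP_layer k sW (sY n)).1.
    by apply: (submodP_layer k sW (sY n)).2.
  - by move=> n x Wx k; apply: layer_sub.
  - by move=> n x /(_ 0%N); apply: layer_ann => //; exact: YU.
have [N HN] : exists N, forall n, (N <= n)%N -> Nd r (Z n) (Z n.+1).
  by apply: H => // n v Zv k; exact: layer_mono (cY n) (Zv k).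
have stab n : exists K, forall k v, (K <= k)%N -> layer W (Y n) k v -> Z n v.
  have [|K HK] := A _ (between_layer (fun=> n) id iU bY).
    by move=> k v; apply: layer_anti.
  exists K => k v le_Kk Zk j; apply: (layer_anti sW (sY n) (leq_maxr K j)).
  by apply: (HK (maxn K j)); [exact: leq_maxl|exact: layer_anti Zk].
exists N => n le_Nn.
have [K1 HK1] := stab n; have [K2 HK2] := stab n.+1.
pose K := maxn K1 K2.
pose F k := addP (Y n) (capP (Y n.+1) (ann_exp W U k)).
have sC k : submodP (capP (Y n.+1) (ann_exp W U k)).
  by apply: submodP_cap => //; exact: submodP_ann_exp.
have sF k : submodP (F k) by apply: submodP_add.
have i1 : itv (Y n) (F K) by split=> // x; apply: addPl.
have FY k x : F k x -> Y n.+1 x.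
  by move=> [y /cY Yy [Yxy _]]; apply: (submodPBl (sY _)) Yxy Yy.
have i2 : itv (F K) (Y n.+1) by split=> //; exact: FY.
apply: (@Nd_ext _ r.+1 _ _ _ i1 i2).
  apply: (Nd_dom (itv_ann_exp K iU)) => //; last first.
    by have [] := ArtNd_ann_exp K iU AH.
  exists (fun v x => Y n (x - v)); split.
  - apply: lrelI => [|b v x v' x' H1 H2]; first by rewrite subrr; exact: (sY n).1.
    by rewrite opprD addrACA -scalerBr; apply: (sY n).2.
  - move=> x [y Yy [_ Xxy]]; exists (x - y) => //.
    by rewrite opprB addrC subrK.
  - by move=> v x /(WY n) Yv Yxv _; apply: (submodPBl (sY n)) Yxv Yv.
(* the kernel of a on Y_(n+1) / F K is F K.+1 / F K because layers beyond K agree *)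
have FK q : Y n.+1 q -> F K (a *: q) -> F K.+1 q.
  move=> Yq [y1 Yy1 [Yu1 [_ Wu1]]].
  have [m Wm] := tors q (YU _ _ Yq).
  have : F (K.+1 + m)%N q.
    apply: addPr => //; split=> //; split; first exact: YU Yq.
    by rewrite exprD -scalerA; apply: submodPZ.
  elim: m {Wm} => [|j IHj]; rewrite ?addn0 // addnS => -[y Yy [Yu [Uu Wu]]].
  apply: IHj; set k := (K.+1 + j)%N in Wu *.
  set u := q - y in Yu Uu Wu; set u1 := a *: q - y1 in Yu1 Wu1.
  pose y' := y1 - a *: y.
  have Ey' : y' = a *: u - u1.
    by rewrite /y' /u /u1 scalerBr opprB [in RHS]addrC -addrA [_ + (_ - _)]addrA
      addNr add0r.
  have Yy' : Y n y' by apply: submodPB => //; exact: submodPZ.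
  have le_Kj : (K <= K + j)%N by exact: leq_addr.
  have Wu1j : W (a ^+ (K + j) *: u1).
    by rewrite addnC exprD -scalerA; apply: submodPZ.
  have : layer W (Y n) (K + j) (a ^+ k *: u).
    exists y'; split=> //; rewrite Ey' [_ *: (_ - u1)]scalerBr.
      rewrite -/k [a ^+ (K + j).+1 *: (a *: u)]scalerA -exprSr.
      apply: submodPB => //; rewrite exprS -scalerA; exact: submodPZ.
    by rewrite [a ^+ _ *: (a *: u)]scalerA -exprSr opprB addrC subrK.
  move/(HK1 _ _ (leq_trans (leq_maxl K1 K2) le_Kj))/(_ k) => [y2 [Yy2 Wy2 Wuy2]].
  exists (y + y2); first exact: submodPD.
  have -> : q - (y + y2) = u - y2 by rewrite /u opprD addrA.
  have Yuy2 : Y n.+1 (u - y2) by apply: submodPB => //; exact: cY.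
  by split=> //; split; [exact: YU Yuy2|rewrite scalerBr].
apply: IHr => //.
  by move=> u Yu; have [k Wk] := tors u (YU _ _ Yu); exists k; apply: addPl; [|exact: WY].
have [sZ WZ ZX] := bZ.
have iZ : itv (Z n) (Z n.+1).
  by split=> // v Zv k; exact: layer_mono (cY n) (Zv k).
have iF := itv_ann_exp 1 i2.
pose rho v q := exists u, [/\ Y n.+1 u, Y n (q - u), W (a ^+ K.+1 *: u) & W (v - a ^+ K *: u)].
apply: (ArtNd_dom iZ iF).
  exists rho; split.
  - apply: lrelI => [|b v x v' x' [u [? ? ? ?]] [u' [? ? ? ?]]].
      by exists 0; rewrite !scaler0 !subr0; split; try apply: submodP0.
    exists (b *: u + u'); split; first exact: (sY _).2.
    + by rewrite opprD addrACA -scalerBr; apply: (sY n).2.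
    + by rewrite scalerDr scalerA mulrC -scalerA; apply: sW.2.
    + by rewrite scalerDr scalerA mulrC -scalerA opprD addrACA -scalerBr; apply: sW.2.
  - move=> q [Yq]; rewrite expr1 => /(FK q Yq)[y Yy [Yu [Uu Wu]]].
    exists (a ^+ K *: (q - y)).
      apply: (HK2 K); first exact: leq_maxr.
      by exists (q - y); rewrite subrr; split=> //; exact: sW.1.
    exists (q - y); split=> //; first by rewrite opprB addrC subrK.
    by rewrite subrr; exact: sW.1.
  - move=> v q /(_ K)[u' [Yu' Wu' Wvu']] [u [Yu Yqu Wu Wvu]] [Yq _].
    exists (q - u + u'); first exact: submodPD.
    have -> : q - (q - u + u') = u - u' by rewrite opprD addrA opprB addrCA subrr addr0.
    have Yuu' : Y n.+1 (u - u') by apply: submodPB => //; exact: cY.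
    split=> //; split; first exact: YU Yuu'.
    have -> : a ^+ K *: (u - u') = (v - a ^+ K *: u') - (v - a ^+ K *: u).
      by rewrite opprB [RHS]addrC addrA subrK scalerBr.
    exact: submodPB.
split; last exact: HN.
move=> D [sD ZD DZ] cD; apply: A => //; split=> // k x; first by move=> Wx; apply/ZD/WZ.
by move=> /DZ; apply: ZX.
Qed.

(** A module on which a is locally nilpotent has Noetherian dimension at most one
    more than the kernel of a. *)
Lemma ArtNd_tors r W U : itv W U ->
  (forall u, U u -> exists k, W (a ^+ k *: u)) ->
  ArtNd r W (ann_exp W U 1) -> ArtNd r.+1 W U.
Proof.
by move=> iU tors H; split; [apply: Art_tors tors H.1|apply: Nd_tors tors H].
Qed.

End TorsionStep.

(** * From intervals back to modules *)

Definition mklin (S : nzRingType) (V V' : lmodType S) (f : V -> V')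
    (lin_f : linear f) : {linear V -> V'} :=
  HB.pack f (GRing.isLinear.Build S V V' _ f lin_f).

Section QuotientMap.
Variables (S : comNzRingType) (V : lmodType S) (W : submodClosed V).

Fact qpi_is_linear : linear (fun x : V => \pi_(quot_mod W)%qT x).
Proof. by move=> a x y; rewrite quot_piD -quot_scale_pi. Qed.

Definition qpi : {linear V -> quot_mod W} := mklin qpi_is_linear.

Lemma qpi_eq0 x : qpi x = 0 <-> x \in W.
Proof.
rewrite -(linear0 qpi) -[in X in _ <-> X](subr0 x) -quot_eqE.
by split=> [H|/eqP //]; apply/eqP.
Qed.

Lemma qpi_surj y : exists x, qpi x = y.
Proof. by exists (repr y)%qT; exact: reprK. Qed.

End QuotientMap.

Lemma Ndim_lt_of_Nd r (X : lmodType R) : Nd r (zeroP : X -> Prop) fullP -> Ndim_lt r X.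
Proof.
elim: r X => [|r IHr] X H; first by move=> x; apply: H.
have [|nH] := pselect (Ndim_lt r X); first by left.
right; split=> // Y cY.
have sY k : submodP (fun x => x \in Y k).
  by split=> [|a u v Yu Yv]; [exact: rpred0|rewrite rpredD ?rpredZ].
have [||n Hn] := H (fun k x => x \in Y k).
- by split=> // k x ->; exact: rpred0.
- by move=> k x; apply: cY.
exists n => k /Hn {}Hn; apply/IHr/(Nd_dom _ _ _ Hn).
- by split=> // x; exact: cY.
- by split=> //; exact: submodP_zero.
exists (fun v q => exists2 u : submod (Y k.+1), val u = v & qpi _ u = q); split.
- apply: lrelI => [|a v x v' x' [u <- <-] [u' <- <-]].
    by exists 0 => //; exact: linear0.
  by exists (a *: u + u') => //; exact: linearP.
- move=> q _; have [u <-] := qpi_surj q; exists (val u); first exact: valP.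
  by exists u.
- by move=> v q Yv [u Eu <-] _; apply/qpi_eq0; rewrite -Eu in Yv.
Qed.

Lemma Ndim_of_Ndim_lt d (X : lmodType R) :
  Ndim_lt d.+1 X -> exists r : int, Ndim X r /\ (r <= d%:Z)%R.
Proof.
elim: d => [|d IHd] [H|H].
- by exists (Negz 0).
- by exists 0.
- have [r [Xr le_rd]] := IHd H; exists r; split=> //.
  apply: (Order.le_trans le_rd); exact: leqnSn.
- by exists d.+1.
Qed.

End Intervals.

Arguments zeroP {R V}.
Arguments fullP {R V}.

(** * Extending partial homomorphisms *)

Section Extending.
Variable S : comNzRingType.

Definition functional (B X : lmodType S) (g : B -> X -> Prop) : Prop :=
  forall y, g 0 y -> y = 0.

(** The domain of g is an ideal of S; stating Baer's condition for relations avoids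
    a module structure on that ideal. *)
Definition baer (X : lmodType S) : Prop :=
  forall g : S^o -> X -> Prop, lrel g -> functional g ->
  exists x, forall a y, g a y -> y = a *: x.

Lemma functionalP (B X : lmodType S) (g : B -> X -> Prop) b y y' :
  lrel g -> functional g -> g b y -> g b y' -> y = y'.
Proof.
move=> sg fg gy gy'; apply/subr0_eq/fg.
by rewrite -(subrr b); apply: lrelB.
Qed.

Lemma total_lrel (B X : lmodType S) (g : B -> X -> Prop) :
  lrel g -> functional g -> (forall b, exists y, g b y) ->
  exists h : {linear B -> X}, forall b y, g b y -> h b = y.
Proof.
move=> sg fg /choice[f gf].
have lin_f : linear f.
  move=> a u v; apply: (functionalP sg fg) (gf _) _.
  exact: lrelP.
by exists (mklin lin_f) => b y; apply: functionalP (gf b).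
Qed.

(** Baer's criterion.  A maximal extension A of g is total: for b outside its
    domain, the partial map a |-> A (a b) from an ideal is given by an element x,
    and b |-> x extends A further. *)
Lemma baer_extend (B X : lmodType S) (g : B -> X -> Prop) :
  baer X -> lrel g -> functional g ->
  exists h : {linear B -> X}, forall b y, g b y -> h b = y.
Proof.
move=> bX sg fg.
pose ext (A : set (B * X)) b y := g b y \/ A (b, y).
pose P (A : set (B * X)) := lrel (ext A) /\ functional (ext A).
have [F FP totF|A [[sA fA] maxA]] := @Zorn_bigcup _ P.
  have join p q : ext (\bigcup_(A in F) A)%classic p.1 p.2 ->
      ext (\bigcup_(A in F) A)%classic q.1 q.2 ->
      (g p.1 p.2 /\ g q.1 q.2) \/
      exists2 A, F A & ext A p.1 p.2 /\ ext A q.1 q.2.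
    case: p q => [p1 p2] [q1 q2] /= [gp|[A FA Ap]] [gq|[A' FA' Aq]].
    - by left.
    - by right; exists A' => //; split; [left|right].
    - by right; exists A => //; split; [right|left].
    - right; have [AA'|A'A] := totF _ _ FA FA'.
        by exists A' => //; split; right => //; exact: AA'.
      by exists A => //; split; right => //; exact: A'A.
  have up A : F A -> forall b y, ext A b y -> ext (\bigcup_(A in F) A)%classic b y.
    by move=> FA b y [gy|Ay]; [left|right; exists A].
  split.
    apply: lrelI; first by left; exact: lrel0.
    move=> a v x v' x' H H'.
    have [[G G']|[A FA [G G']]] := join (v, x) (v', x') H H'.
      by left; exact: lrelP.
    by apply: (up A FA); apply: lrelP => //; case: (FP A FA).
  move=> y H; have [[G _]|[A FA [G _]]] := join (0, y) (0, y) H H; first exact: fg.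
  by have [_ fA] := FP A FA; exact: fA.
have maxG (G : B -> X -> Prop) : lrel G -> functional G ->
    (forall b y, ext A b y -> G b y) -> forall b y, G b y -> ext A b y.
  move=> sG fG AG b y Gby; apply: contrapT => nA.
  apply: (maxA (fun p => G p.1 p.2)).
    split=> [[b' y'] /= Ay|H]; first by apply: AG; right.
    by apply: nA; right; exact: (H (b, y)).
  have EG b' y' : ext (fun p => G p.1 p.2) b' y' <-> G b' y'.
    by split=> [[gy|//]|]; [apply: AG; left|right].
  split; last by move=> y' /EG/fG.
  apply: lrelI => [|a v x v' x' /EG H /EG H']; first by apply/EG; exact: lrel0.
  by apply/EG; exact: lrelP.
have totA b : exists y, ext A b y.
  have [||x Hx] := bX (fun a y => ext A (a *: b) y).
  - apply: lrelI => [|a v x v' x' H H']; first by rewrite scale0r; exact: lrel0.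
    by rewrite scalerDl -scalerA; apply: lrelP.
  - by move=> y; rewrite scale0r; exact: fA.
  exists x; apply: (maxG (fun c y => exists a : S, ext A (c - a *: b) (y - a *: x))).
  - apply: lrelI => [|a v y v' y' [c H] [c' H']].
      by exists 0; rewrite !scale0r !subr0; exact: lrel0.
    exists (a * c + c'); rewrite !scalerDl -!scalerA !opprD.
    by rewrite !(addrACA (a *: _) _ (- _)) -!scalerBr; apply: lrelP.
  - move=> y [a]; rewrite sub0r -scaleNr => H.
    have := Hx _ _ H; rewrite scaleNr => /eqP.
    by rewrite subr_eq addNr => /eqP.
  - by move=> c y H; exists 0; rewrite !scale0r !subr0.
  - by exists 1; rewrite !scale1r !subrr; exact: lrel0.
have [h hA] := total_lrel sA fA totA.
by exists h => b y gy; apply: hA; left.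
Qed.

(** The graph of g is a submodule of B x X on which the first projection is
    injective; the second projection extends along it. *)
Lemma injective_extend (B X : lmodType S) (g : B -> X -> Prop) :
  injective_module X -> lrel g -> functional g ->
  exists h : {linear B -> X}, forall b y, g b y -> h b = y.
Proof.
move=> iX sg fg.
pose G : {pred (B * X)%type} := fun p => `[< g p.1 p.2 >].
have GP p : reflect (g p.1 p.2) (p \in G) by exact: asboolP.
have sG : submod_closed G.
  split=> [|a [u x] [v y]]; first by apply/GP; exact: lrel0.
  by move=> /GP Gu /GP Gv; apply/GP; exact: lrelP.
pose GS : submodClosed (B * X)%type := HB.pack G (GRing.isSubmodClosed.Build S _ G sG).
have lin1 : linear (fun p : submod GS => (val p).1) by [].
have lin2 : linear (fun p : submod GS => (val p).2) by [].
have inj1 : injective (mklin lin1).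
  move=> [[b y] /= Gy] [[b' y'] /= Gy'] /= Eb; apply: val_inj => /=.
  rewrite -Eb in Gy' *; congr (_, _); apply: functionalP fg _ _ => //.
    exact/(GP (b, y)).
  exact/(GP (b, y')).
have [h Hh] := iX _ _ (mklin lin1) (mklin lin2) inj1.
exists h => b y gy; have Gby : (b, y) \in GS by apply/(GP (b, y)).
exact: (Hh (Submod Gby)).
Qed.

End Extending.

Lemma injective_of_extend (S : comNzRingType) (X : lmodType S) :
  (forall (B : lmodType S) (g : B -> X -> Prop), lrel g -> functional g ->
    exists h : {linear B -> X}, forall b y, g b y -> h b = y) ->
  injective_module X.
Proof.
move=> H A B f g inj_f.
have [||h Hh] := H B (fun b y => exists2 a, f a = b & g a = y).
- apply: lrelI => [|a v x v' x' [u <- <-] [u' <- <-]]; first by exists 0; exact: linear0.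
  by exists (a *: u + u'); exact: linearP.
- move=> y [a fa0 <-]; suff -> : a = 0 by exact: linear0.
  by apply: inj_f; rewrite linear0.
- by exists h => a; apply: Hh; exists a.
Qed.

(** * Enough injectives *)

Definition int_pred : {pred zmodule rat} := fun q => `[< exists n : int, q = n%:~R >].

Fact int_pred_closed : submod_closed int_pred.
Proof.
split=> [|a u v]; first by apply/asboolP; exists 0.
move=> /asboolP[m ->] /asboolP[n ->]; apply/asboolP; exists (m * a + n).
by rewrite scalezrE rmorphD rmorphM /= mulrzr.
Qed.

HB.instance Definition _ := GRing.isSubmodClosed.Build int (zmodule rat) int_pred int_pred_closed.

Definition QZ : lmodType int := quot_mod int_pred.
Definition qz (q : rat) : QZ := qpi int_pred (q : zmodule rat).

Lemma qz_eq0 q : qz q = 0 <-> exists n : int, q = n%:~R.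
Proof. by split=> [/qpi_eq0/asboolP|H]; last by apply/qpi_eq0/asboolP. Qed.

Lemma qz_scale (a : int) q : a *: qz q = qz (a%:~R * q).
Proof. by rewrite -linearZ mulrzl. Qed.

(** Serves both for the domains of partial maps from Z and for annihilators of
    elements of abelian groups. *)
Lemma int_ideal_gen (J : int -> Prop) : J 0 ->
  (forall a b c, J b -> J c -> J (a * b + c)) ->
  exists n : nat, J n /\ forall a, J a -> exists k, a = k * n%:Z.
Proof.
move=> J0 JD; have JZ a b : J b -> J (a * b).
  by move=> Jb; rewrite -[_ * _]addr0; apply: JD.
have [H|H] := pselect (exists n : nat, `[< (0 < n)%N /\ J n >]); last first.
  exists 0%N; split=> // a Ja; exists 0; rewrite mul0r; apply: contrapT => /eqP a0.
  apply: H; exists `|a|%N; apply/asboolP; rewrite absz_gt0; split=> //.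
  by rewrite abszEsg; apply: JZ.
case: (ex_minnP H) => n /asboolP[n_gt0 Jn] minn; exists n; split=> // a Ja.
exists (a %/ n)%Z; have Ea := divz_eq a n.
suff E : (a %% n)%Z = 0 by rewrite [LHS]Ea E addr0.
have Jr : J (a %% n)%Z by rewrite /modz addrC -mulNr; apply: JD.
have r_ge0 : (0 <= (a %% n)%Z)%R by apply: modz_ge0; rewrite -lt0n.
have ltr : ((a %% n)%Z < n)%R by apply: ltz_pmod.
case: (a %% n)%Z Jr r_ge0 ltr => // r Jr _; rewrite ltz_nat => lt_rn.
case: r => // r in Jr lt_rn *; have /minn : `[< (0 < r.+1)%N /\ J r.+1 >] by apply/asboolP.
by rewrite leqNgt lt_rn.
Qed.

(** Q/Z is divisible and the ideals of Z are principal. *)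
Lemma baer_QZ : baer QZ.
Proof.
move=> g sg fg.
have [||n [[yn gn] Hn]] := int_ideal_gen (J := fun a => exists y, g a y).
- by exists 0; exact: (lrel0 sg).
- by move=> a b c [y gb] [z gc]; exists (a *: y + z); exact: (lrelP sg).
have [q Eq] := qpi_surj yn.
have [n0|n0] := eqVneq n 0%N.
  exists 0 => a y gay; have [k] : exists k, a = k * n%:Z by apply: Hn; exists y.
  by rewrite n0 mulr0 scaler0 => a0; apply: fg; rewrite -a0.
exists (qz (q / n%:~R)) => a y gay.
have [k Ea] : exists k, a = k * n%:Z by apply: Hn; exists y.
have -> : y = k *: yn by apply: (functionalP sg fg gay); rewrite Ea; exact: (lrelZ sg).
rewrite Ea -scalerA -Eq (qz_scale n) [_ * (q / _)]mulrC divfK ?intr_eq0 //.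
Qed.

Section Cofree.
Variables (R : comNzRingType) (X : Type).

(** The R-module of additive maps from R to (Q/Z)^X.  Homomorphisms from B to it are
    the families, indexed by X, of additive maps B -> Q/Z. *)
Record cofree := Cofree {
  cofree_val :> R -> X -> QZ;
  cofree_add : forall r s x, cofree_val (r + s) x = cofree_val r x + cofree_val s x
}.

Lemma cofreeP (f g : cofree) : (forall r x, f r x = g r x) -> f = g.
Proof.
case: f g => [f fD] [g gD] /= fg; have E : f = g by apply/funext => r; apply/funext => x.
by rewrite E in fD *; congr Cofree; exact: Prop_irrelevance.
Qed.

HB.instance Definition _ := gen_eqMixin cofree.
HB.instance Definition _ := gen_choiceMixin cofree.

Definition cofree0 : cofree.
Proof. by exists (fun _ _ => 0) => r s x; rewrite addr0. Defined.

Definition cofree_plus (f g : cofree) : cofree.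
Proof.
by exists (fun r x => f r x + g r x) => r s x; rewrite !cofree_add addrACA.
Defined.

Definition cofree_opp (f : cofree) : cofree.
Proof.
by exists (fun r x => - f r x) => r s x; rewrite cofree_add opprD.
Defined.

Fact cofree_plusA : associative cofree_plus.
Proof. by move=> f g h; apply: cofreeP => r x /=; rewrite addrA. Qed.
Fact cofree_plusC : commutative cofree_plus.
Proof. by move=> f g; apply: cofreeP => r x /=; rewrite addrC. Qed.
Fact cofree_plus0 : left_id cofree0 cofree_plus.
Proof. by move=> f; apply: cofreeP => r x /=; rewrite add0r. Qed.
Fact cofree_plusN : left_inverse cofree0 cofree_opp cofree_plus.
Proof. by move=> f; apply: cofreeP => r x /=; rewrite addNr. Qed.

HB.instance Definition _ := GRing.isZmodule.Build cofree
  cofree_plusA cofree_plusC cofree_plus0 cofree_plusN.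

Definition cofree_scale (a : R) (f : cofree) : cofree.
Proof.
by exists (fun r x => f (r * a) x) => r s x; rewrite mulrDl cofree_add.
Defined.

Fact cofree_scaleA a b f : cofree_scale a (cofree_scale b f) = cofree_scale (a * b) f.
Proof. by apply: cofreeP => r x /=; rewrite mulrA. Qed.
Fact cofree_scale1 f : cofree_scale 1 f = f.
Proof. by apply: cofreeP => r x /=; rewrite mulr1. Qed.
Fact cofree_scaleDr a f g : cofree_scale a (f + g) = cofree_scale a f + cofree_scale a g.
Proof. exact: cofreeP. Qed.
Fact cofree_scaleDl f a b : cofree_scale (a + b) f = cofree_scale a f + cofree_scale b f.
Proof. by apply: cofreeP => r x /=; rewrite mulrDr cofree_add. Qed.

HB.instance Definition _ := GRing.Zmodule_isLmodule.Build R cofree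
  cofree_scaleA cofree_scale1 cofree_scaleDr cofree_scaleDl.

Lemma cofree_int (f : cofree) (a : int) x : f a%:~R x = a *: f 1 x.
Proof.
have add_f : zmod_morphism (fun r => f r x).
  by move=> r s /=; apply/esym/eqP; rewrite subr_eq -cofree_add subrK.
pose F : {additive R -> QZ} := HB.pack (fun r => f r x)
  (GRing.isZmodMorphism.Build _ _ _ add_f).
by rewrite -[X in X *: f 1 x]intz scaler_int -[LHS]/(F _) raddfMz.
Qed.

(** Evaluation at 1 turns the problem into extending, for each index, an additive
    map to the injective abelian group Q/Z. *)
Lemma injective_cofree : injective_module cofree.
Proof.
apply: injective_of_extend => B g sg fg.
have H x : exists h : {linear zmodule B -> QZ},
    forall b t, (exists2 y, g b y & (y : cofree) 1 x = t) -> h b = t.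
  apply: baer_extend baer_QZ _ _.
    apply: lrelI => [|a u t u' t' [y gy <-] [y' gy' <-]].
      by exists 0; [exact: lrel0|].
    exists (a%:~R *: y + y').
      by rewrite scalezrE -scaler_int; exact: lrelP.
    by rewrite /= mul1r cofree_int.
  by move=> t [y /fg -> <-].
have [h Hh] := choice H.
have addh b : forall r s x, h x ((r + s) *: b : B) = h x (r *: b : B) + h x (s *: b : B).
  by move=> r s x; rewrite scalerDl; exact: (linearD (h x)).
pose F b := Cofree (addh b).
have lin_F : linear F.
  move=> a b b'; apply: cofreeP => r x /=.
  by rewrite scalerDr scalerA; exact: (linearD (h x)).
exists (mklin lin_F) => b y gy; apply: cofreeP => r x /=.
apply: Hh; exists (r *: y); first exact: lrelZ.
by rewrite /= mul1r.
Qed.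

End Cofree.

Section Hull.
Variables (R : comNzRingType) (M : lmodType R).

(** Z m embeds a nonzero cyclic group in Q/Z or maps onto the subgroup of order 2. *)
Lemma character (m : M) : m <> 0 -> exists chi : {linear zmodule M -> QZ}, chi m <> 0.
Proof.
move=> m0.
have [||n [nm Hn]] := int_ideal_gen (J := fun a => a *: (m : zmodule M) = 0).
- exact: scale0r.
- by move=> a b c bm cm; rewrite scalerDl -scalerA bm cm scaler0 addr0.
have n1 : n != 1%N.
  by apply/eqP => n1; apply: m0; rewrite n1 in nm; rewrite -[m](scale1r (m : zmodule M)).
(* a nonzero element of Q/Z killed by the annihilator nZ of m *)
pose N := if n == 0%N then 2%N else n.
have [N_gt0 N1] : (0 < N)%N /\ N != 1%N by rewrite /N; case: eqP => // /eqP; rewrite -lt0n.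
pose t := qz N%:R^-1.
have t0 : t <> 0.
  move=> /qz_eq0[z Ez]; have : (z * N)%:~R = 1 :> rat.
    by rewrite rmorphM /= -Ez mulVf // Num.Theory.pnatr_eq0 -lt0n.
  move=> /eqP; rewrite -[1]/(1%:~R) eqr_int => /eqP zN.
  have : (N %| absz (z * N)%R)%N by rewrite abszM dvdn_mull.
  by rewrite zN dvdn1 (negPf N1).
have Jt a : a *: (m : zmodule M) = 0 -> a *: t = 0.
  move=> /Hn[k ->]; rewrite /t qz_scale; apply/qz_eq0; exists (if n == 0%N then 0 else k).
  rewrite rmorphM /= /N; case: eqP => [->|/eqP n0]; first by rewrite mulr0 mul0r.
  by rewrite mulfK ?Num.Theory.pnatr_eq0.
have [||chi Hchi] := @baer_extend _ (zmodule M) QZ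
  (fun b y => exists a : int, b = a *: (m : zmodule M) /\ y = a *: t) baer_QZ.
- apply: lrelI => [|a b y b' y' [c [-> ->]] [c' [-> ->]]].
    by exists 0; rewrite !scale0r.
  by exists (a * c + c'); rewrite !scalerDl !scalerA.
- by move=> y [a [/esym/Jt E ->]].
- by exists chi; rewrite (Hchi _ t) //; exists 1; rewrite !scale1r.
Qed.

(** M embeds by sending m to the family of all additive maps to Q/Z evaluated on
    the multiples of m. *)
Definition hull : lmodType R := cofree R {linear zmodule M -> QZ}.

Definition hull_val (m : M) : hull.
Proof.
exists (fun r (chi : {linear zmodule M -> QZ}) => chi (r *: m : M)) => r s chi.
by rewrite scalerDl; exact: (linearD chi).
Defined.

Fact hull_val_is_linear : linear hull_val.
Proof.
move=> a m m'; apply: cofreeP => r chi /=.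
by rewrite scalerDr scalerA; exact: (linearD chi).
Qed.

Definition to_hull : {linear M -> hull} := mklin hull_val_is_linear.

Lemma to_hull_eq0 m : to_hull m = 0 -> m = 0.
Proof.
move=> m0; apply: contrapT => /character[chi []].
by rewrite -[m]scale1r -[LHS]/(to_hull m 1 chi) m0.
Qed.

Lemma injective_hull : injective_module hull.
Proof. exact: injective_cofree. Qed.

End Hull.

(** * Ideals of a Noetherian ring *)

Section Noetherian.
Variable R : comNzRingType.
Hypothesis noethR : noetherian R.
Implicit Types J K : R^o -> Prop.

Lemma noetherian_gens J : submodP J -> exists n (s : 'I_n -> R^o),
  (forall i, J (s i)) /\ forall x, J x -> exists c : 'I_n -> R, x = \sum_i c i *: s i.
Proof.
move=> sJ; pose P : {pred R^o} := fun x => `[< J x >].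
have PP x : reflect (J x) (x \in P) by exact: asboolP.
have cP : submod_closed P.
  split=> [|a u v]; first by apply/PP; exact: sJ.1.
  by move=> /PP Ju /PP Jv; apply/PP; exact: sJ.2.
have [n [s [sP sG]]] := noethR (HB.pack P (GRing.isSubmodClosed.Build R _ P cP)).
exists n, s; split=> [i|x /PP/sG //]; exact/PP/sP.
Qed.

Lemma noetherian_acc (Y : nat -> R^o -> Prop) : (forall k, submodP (Y k)) ->
  (forall k x, Y k x -> Y k.+1 x) ->
  exists n, forall k, (n <= k)%N -> forall x, Y k x -> Y n x.
Proof.
move=> sY cY; have [|n [s [sU sG]]] := @noetherian_gens (fun x => exists k, Y k x).
  split; first by exists 0%N; exact: (sY _).1.
  move=> a u v [k Yu] [k' Yv]; exists (maxn k k'); apply: (sY (maxn k k')).2.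
    exact: (chain_le cY (leq_maxl k k')).
  exact: (chain_le cY (leq_maxr k k')).
have [f Hf] := choice sU.
exists (\max_i f i) => k _ x Yx.
have [|c ->] := sG x; first by exists k.
apply: (big_ind (Y (\max_i f i)%N)) => [|u v|i _]; first exact: (sY _).1.
  exact: submodPD.
by apply: submodPZ => //; apply: (chain_le cY (leq_bigmax i)).
Qed.

Lemma noetherian_ind (P : (R^o -> Prop) -> Prop) :
  (forall J, submodP J -> (forall K a, submodP K -> (forall x, J x -> K x) ->
     K a -> ~ J a -> P K) -> P J) ->
  forall J, submodP J -> P J.
Proof.
move=> step J sJ; apply: contrapT => nPJ.
pose T := {K : R^o -> Prop | submodP K /\ ~ P K}.
have next (K : T) : exists K' : T,
    (forall x, sval K x -> sval K' x) /\ exists2 a, sval K' a & ~ sval K a.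
  case: K => K [sK nPK] /=; apply: contrapT => H; apply: nPK; apply: step => // K' a sK' KK' K'a Ka.
  apply: contrapT => nPK'; apply: H.
  by exists (exist _ K' (conj sK' nPK')); split=> //; exists a.
have [f Hf] := choice next.
pose Y k := iter k f (exist _ J (conj sJ nPJ) : T).
have [||n Hn] := @noetherian_acc (fun k => sval (Y k)).
- by move=> k; case: (Y k) => ? [].
- by move=> k; have [] := Hf (Y k).
- by have [_ [a Ya []]] := Hf (Y n); apply: (Hn n.+1).
Qed.

(** * Torsion with respect to an ideal *)

Variable I : idealr R.

(** For finitely generated I this agrees with being killed by a power of I; in
    this elementwise form, extensions of torsion by torsion are visibly torsion. *)
Definition tors (V : lmodType R) (x : V) : Prop :=
  forall a, a \in I -> exists k, a ^+ k *: x = 0.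

Lemma scaler_expD (V : lmodType R) (a : R) (x : V) (k n : nat) :
  (k <= n)%N -> a ^+ k *: x = 0 -> a ^+ n *: x = 0.
Proof.
by move=> /subnK <- x0; rewrite exprD -scalerA x0 scaler0.
Qed.

Lemma submodP_tors (V : lmodType R) : submodP (@tors V).
Proof.
split=> [a _|b u v tu tv a Ia]; first by exists 0%N; rewrite scaler0.
have [k ku] := tu a Ia; have [n nv] := tv a Ia; exists (maxn k n).
rewrite scalerDr (scaler_expD (leq_maxr k n) nv) scalerA mulrC -scalerA.
by rewrite (scaler_expD (leq_maxl k n) ku) scaler0 addr0.
Qed.

Lemma tors_linear (V V' : lmodType R) (f : {linear V -> V'}) x :
  tors x -> tors (f x).
Proof.
by move=> tx a /tx[k kx]; exists k; rewrite -linearZ kx linear0.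
Qed.

Lemma tors_ext (V : lmodType R) (x : V) :
  (forall a, a \in I -> exists k, tors (a ^+ k *: x)) -> tors x.
Proof.
move=> H a Ia; have [k /(_ a Ia)[n E]] := H a Ia.
by exists (n + k)%N; rewrite exprD -scalerA.
Qed.

(** I^(n+1) x is spanned by the I^n (s i) x. *)
Lemma exp_kill (V : lmodType R) (x : V) r (s : 'I_r -> R) :
  (forall a, a \in I -> exists c : 'I_r -> R, a = \sum_i c i * s i) ->
  (forall i, exists k, forall a, ideal_exp I k a -> a *: (s i *: x) = 0) ->
  exists n, forall a, ideal_exp I n a -> a *: x = 0.
Proof.
move=> sG /choice[g Hg]; exists (\max_i g i).+1 => _ [l [lI ->]].
rewrite scaler_suml big_seq big1 // => p /lI[/sG[c ->] Ip].
rewrite mulr_suml scaler_suml big1 // => i _.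
rewrite mulrAC -!scalerA Hg ?scaler0 //.
exact: ideal_exp_anti (leq_bigmax i) Ip.
Qed.

Lemma tors_torsion (V : lmodType R) (x : V) : x \in torsion I V <-> tors x.
Proof.
split=> [/asboolP[n nx] a Ia|tx].
  exists n; apply: nx; elim: n => [//|n IHn]; exists [:: (a, a ^+ n)].
  by split=> [p|]; rewrite ?inE; [move=> /eqP->|rewrite big_seq1 exprS].
have [|r [s [sI sG]]] := @noetherian_gens (fun a => a \in I).
  by split=> [|a u v Iu Iv]; [exact: idealr0|rewrite rpredD ?idealMr].
apply/asboolP.
have /choice[f Hf] i : exists k, s i ^+ k *: x = 0 by exact: tx.
(* induction on the total exponent: each s i *: x is killed by smaller ones *)
have [N leN] : exists N, (\sum_i f i <= N)%N by exists (\sum_i f i)%N.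
elim: N x f {tx} Hf leN => [|N IHN] x f Hf leN.
all: apply: (exp_kill sG) => i; case Ef: (f i) => [|m].
1,3: by exists 0%N => a _; have := Hf i; rewrite Ef expr0 scale1r => ->; rewrite !scaler0.
  by move: leN; rewrite (bigD1 i) //= Ef.
apply: (IHN _ (fun j => if j == i then m else f j)) => [j|].
  case: eqP => [->|_]; first by rewrite scalerA -exprSr -Ef Hf.
  by rewrite scalerA mulrC -scalerA Hf scaler0.
move: leN; rewrite (bigD1 i) //= Ef addSn ltnS => leN.
by rewrite (bigD1 i) //= eqxx (eq_bigr f) // => j /negPf->.
Qed.

(** * The torsion of an injective module is a direct summand *)

Definition tors_pred (V : lmodType R) : {pred V} := fun x => `[< tors x >].

Fact tors_pred_closed (V : lmodType R) : submod_closed (@tors_pred V).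
Proof.
split=> [|a u v]; first by apply/asboolP; exact: (submodP_tors V).1.
by move=> /asboolP tu /asboolP tv; apply/asboolP; exact: (submodP_tors V).2.
Qed.

HB.instance Definition _ (V : lmodType R) :=
  GRing.isSubmodClosed.Build R V (@tors_pred V) (@tors_pred_closed V).

Lemma tors_predP (V : lmodType R) (x : V) : reflect (tors x) (x \in @tors_pred V).
Proof. exact: asboolP. Qed.

(** A weak form of the Artin-Rees lemma.  Among the ideals K containing N and
    meeting J inside N, a maximal one contains a power of each a in I: otherwise
    enlarge K by a^m, where m is such that (K : a^m) = (K : a^k) for all k >= m.
    If b in J is congruent to c a^m modulo K, then a^k b lies in N for some k, hence
    a^m b lies in K, so a^(2m) c does, so a^m c does, so b does. *)
Lemma artin_rees J (N : R^o -> Prop) : submodP J -> submodP N ->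
  (forall a, a \in I -> exists k, forall b, J b -> N (a ^+ k * b)) ->
  exists K, [/\ submodP K, forall b, K b -> J b -> N b
    & forall a, a \in I -> exists k, K (a ^+ k)].
Proof.
move=> sJ sN JN.
pose good K := (forall b, N b -> K b) -> (forall b, K b -> J b -> N b) ->
  exists K', [/\ submodP K', forall b, K' b -> J b -> N b
    & forall a, a \in I -> exists k, K' (a ^+ k)].
suff H K : submodP K -> good K by apply: (H N).
apply: noetherian_ind => {}K sK IHK NK KJ.
have [H|/existsNP[a /not_implyP[Ia /forallNP na]]] :=
  pselect (forall a, a \in I -> exists k, K (a ^+ k)); first by exists K.
have [||m Hm] := @noetherian_acc (fun m b => K (a ^+ m * b)).
- move=> k; split=> [|c u v Ku Kv]; first by rewrite mulr0; exact: sK.1.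
  by rewrite mulrDr mulrCA; exact: sK.2.
- by move=> k b Kb; rewrite exprS -mulrA; exact: (submodPZ sK).
have {Hm} Hm k b : K (a ^+ k * b) -> K (a ^+ m * b).
  move=> Kb; apply: (Hm (m + k)%N); first exact: leq_addr.
  by rewrite exprD -mulrA; exact: (submodPZ sK).
apply: (IHK (fun b => exists c : R, K (b - c * a ^+ m)) (a ^+ m)).
- split=> [|d u v [c Kc] [c' Kc']]; first by exists 0; rewrite mul0r subr0; exact: sK.1.
  exists (d * c + c'); rewrite mulrDl opprD addrACA -mulrA -mulrBr.
  exact: sK.2.
- by move=> b Kb; exists 0; rewrite mul0r subr0.
- by exists 1; rewrite mul1r subrr; exact: sK.1.
- exact: na.
- by move=> b /NK Kb; exists 0; rewrite mul0r subr0.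
move=> b [c Kc] Jb; apply: (KJ b _ Jb); have [k /(_ b Jb)/NK/Hm Kb] := JN a Ia.
have : K (a ^+ (m + m) * c).
  have := submodPB sK Kb (submodPZ sK (a ^+ m) Kc).
  by rewrite -[_ *: _]/(_ * _) -mulrBr opprB addrCA subrr addr0 mulrCA -exprD mulrC.
move/Hm => Kac; apply: (submodPBl sK Kc).
by rewrite mulrC.
Qed.

(** A partial map g from J to the torsion of E vanishes on a power of a times J, for
    each a in I, so artin_rees gives an ideal K on which g can be extended by 0.
    The image of 1 under an extension of the result to R is killed by K, hence is
    torsion. *)
Lemma baer_tors (E : lmodType R) :
  injective_module E -> baer (submod (@tors_pred E)).
Proof.
move=> iE g sg fg.
pose J b := exists y, g b y.
pose N b := g b 0.
have sJ : submodP J.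
  split; first by exists 0; exact: lrel0.
  by move=> a u v [y gy] [z gz]; exists (a *: y + z); exact: lrelP.
have sN : submodP N.
  split; first exact: lrel0.
  by move=> a u v gu gv; rewrite /N -[0](addr0 0) -{1}(scaler0 _ a); exact: lrelP.
have JN a : a \in I -> exists k, forall b, J b -> N (a ^+ k * b).
  move=> Ia; have [n [s [sJs sG]]] := noetherian_gens sJ.
  have [f Hf] := choice sJs.
  have /choice[k Hk] i : exists k, a ^+ k *: f i = 0.
    have /tors_predP/(_ a Ia)[k E0] := valP (f i).
    by exists k; apply: val_inj.
  exists (\max_i k i) => b /sG[c ->]; rewrite mulr_sumr.
  apply: (big_ind N) => [|u v|i _]; first exact: sN.1.
    exact: submodPD.
  rewrite -[_ * _]/(_ *: (_ *: _)) scalerA mulrC -scalerA; apply: submodPZ => //.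
  rewrite /N -(scaler_expD (leq_bigmax i) (Hk i)); exact: lrelZ.
have [K [sK KJ IK]] := artin_rees sJ sN JN.
have [||h Hh] := @injective_extend _ R^o E
  (fun b y => exists c z, [/\ g c z, K (b - c) & y = val z]) iE.
- apply: lrelI => [|a b y b' y' [c [z [gc Kc ->]]] [c' [z' [gc' Kc' ->]]]].
    by exists 0, 0; rewrite subrr; split=> //; [exact: lrel0|exact: sK.1].
  exists (a *: c + c'), (a *: z + z'); split=> //; first exact: lrelP.
  by rewrite opprD addrACA -scalerBr; exact: sK.2.
- move=> y [c [z [gc Kc ->]]].
  have Nc : N c.
    by apply: KJ; [rewrite -[c]opprK -[- c]sub0r; exact: submodPN|exists z].
  by rewrite (functionalP sg fg gc Nc).
have hE b : h b = b *: h 1 by rewrite -linearZ; congr (h _); rewrite /GRing.scale /= mulr1.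
have t1 : h 1 \in @tors_pred E.
  apply/tors_predP => a /IK[k Kk]; exists k; rewrite -hE; apply: Hh.
  by exists 0, 0; rewrite subr0; split=> //; exact: lrel0.
exists (Submod t1) => a y gy; apply: val_inj => /=.
rewrite -hE; apply/esym/Hh; exists a, y; rewrite subrr; split=> //; exact: sK.1.
Qed.

Lemma tors_retraction (E : lmodType R) : injective_module E ->
  exists t : {linear E -> E}, forall e, tors (t e) /\ (tors e -> t e = e).
Proof.
move=> iE; have bT := baer_tors iE.
have [||h Hh] := baer_extend (B := E) (g := fun e z => e = val z) bT.
- by apply: lrelI => // a v x v' x' -> ->.
- by move=> y /esym y0; apply: val_inj.
have lin : linear (fun e => val (h e)) by move=> a u v; rewrite linearP.
exists (mklin lin) => e /=; split=> [|te]; first exact/tors_predP/valP.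
have te' : e \in @tors_pred E by exact/tors_predP.
by rewrite (Hh e (Submod te')).
Qed.

End Noetherian.

(** * Complexes of injective modules and their torsion subcomplexes *)

Section Complexes.
Variable R : comNzRingType.

Record complex := Complex {
  obj :> nat -> lmodType R;
  diff : forall i, {linear obj i -> obj i.+1};
  diffK : forall i x, diff i.+1 (diff i x) = 0
}.

Definition injective_complex (E : complex) := forall i, injective_module (E i).
Definition trivial (V : lmodType R) := forall x : V, x = 0.
Definition exact_at (E : complex) j :=
  forall x : E j.+1, diff E j.+1 x = 0 -> exists y, diff E j y = x.

Lemma injective_prod (V V' : lmodType R) :
  injective_module V -> injective_module V' -> injective_module (V * V')%type.
Proof.
move=> iV iV' A B f g inj_f.
have [h Hh] := iV A B f (fst \o g)%FUN inj_f.
have [h' Hh'] := iV' A B f (snd \o g)%FUN inj_f.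
have lin : linear (fun b => (h b, h' b)) by move=> a u v; rewrite !linearP.
by exists (mklin lin) => a /=; rewrite Hh Hh' /=; case: (g a).
Qed.

Lemma injective_trivial (V : lmodType R) : trivial V -> injective_module V.
Proof. by move=> V0 A B f g _; exists \0 => a; rewrite [RHS]V0. Qed.

(** Putting the zero module in degree 0 avoids a case distinction on the degree in
    the mapping cone, and makes the coboundaries in every degree images of a map. *)
Section Shift.
Variable F : complex.

Definition shift_obj j : lmodType R := if j is i.+1 then F i else 'rV[R]_0.

Definition shift_diff j : {linear shift_obj j -> shift_obj j.+1} :=
  match j with 0 => \0 | i.+1 => diff F i end.

Fact shift_diffK j x : shift_diff j.+1 (shift_diff j x) = 0.
Proof. by case: j x => [|j] x /=; [rewrite linear0|exact: diffK]. Qed.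

Definition shift := Complex shift_diffK.

Lemma trivial_rV0 : trivial 'rV[R]_0.
Proof. by move=> x; rewrite (thinmx0 x). Qed.

Lemma injective_shift : injective_complex F -> injective_complex shift.
Proof. by move=> iF [|i]; [exact/injective_trivial/trivial_rV0|exact: iF]. Qed.

End Shift.

Section Cone.
Variables (E F : complex) (f : forall j, {linear E j -> F j}).
Hypothesis fC : forall j e, f j.+1 (diff E j e) = diff F j (f j e).

Definition cone_obj j : lmodType R := (E j * shift F j)%type.

Definition cone_fun j (c : cone_obj j) : cone_obj j.+1 :=
  (diff E j c.1, f j c.1 - diff (shift F) j c.2).

Fact cone_fun_is_linear j : linear (@cone_fun j).
Proof.
move=> a [e g] [e' g']; rewrite /cone_fun /= !linearP; congr (_, _).
by rewrite addrACA -scalerDr.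
Qed.

Definition cone_diff j : {linear cone_obj j -> cone_obj j.+1} :=
  mklin (@cone_fun_is_linear j).

Fact cone_diffK j x : cone_diff j.+1 (cone_diff j x) = 0.
Proof.
case: x => e g; rewrite /= /cone_fun /= diffK fC -[RHS]/(0, 0); congr (_, _).
have D : diff F j (diff (shift F) j g) = 0 := @diffK (shift F) j g.
by rewrite linearB D subr0 subrr.
Qed.

Definition cone := Complex cone_diffK.

Lemma injective_cone :
  injective_complex E -> injective_complex F -> injective_complex cone.
Proof.
by move=> iE iF j; apply: injective_prod; [exact: iE|exact: injective_shift].
Qed.

Lemma cone_exact j (e : E j) (g : shift F j.+1) : exact_at (shift F) j ->
  diff cone j.+1 (diff E j e, g) = 0 -> exists c, diff cone j c = (diff E j e, g).
Proof.
move=> exF [_]; rewrite fC -linearB => /(exF (f j e - g))[h Eh].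
by exists (e, h); rewrite /= /cone_fun /= -[shift_diff F j h]/(diff (shift F) j h) Eh subKr.
Qed.

End Cone.

End Complexes.

Section TorsionSubcomplex.
Variable R : comNzRingType.
Hypothesis noethR : noetherian R.
Variable I : idealr R.
Local Notation tors := (tors I).

(** The quotient of these two is the cohomology, in degree j.+1, of the complex of
    torsion submodules of E.  The degrees are offset by one so that
    degree j always exists; the complexes of interest vanish in degree 0. *)
Definition tors_cocycles (E : complex R) j : E j -> Prop :=
  fun x => tors x /\ diff E j x = 0.
Definition tors_coboundaries (E : complex R) j : E j.+1 -> Prop :=
  fun x => exists2 y, tors y & diff E j y = x.
Definition HNd r (E : complex R) j := ArtNd r (@tors_coboundaries E j) (@tors_cocycles E j.+1).

Lemma itv_cohomology (E : complex R) j : itv (@tors_coboundaries E j) (@tors_cocycles E j.+1).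
Proof.
split.
- split; first by exists 0; [exact: (submodP_tors I _).1|exact: linear0].
  move=> a u v [y ty <-] [z tz <-]; exists (a *: y + z); last exact: linearP.
  exact: (submodP_tors I _).2.
- split; first by split; [exact: (submodP_tors I _).1|exact: linear0].
  move=> a u v [tu du] [tv dv]; split; first exact: (submodP_tors I _).2.
  by rewrite linearP du dv scaler0 addr0.
- by move=> x [y ty <-]; split; [exact: tors_linear|exact: diffK].
Qed.

Definition tors_at (E : complex R) j := forall x : E j.+1, diff E j.+1 x = 0 ->
  forall a, a \in I -> exists k y, diff E j y = a ^+ k *: x.

Lemma exact_tors_at (E : complex R) j : exact_at E j -> tors_at E j.
Proof. by move=> ex x /ex[y Ey] a _; exists 0%N, y; rewrite expr0 scale1r. Qed.

(** Modulo torsion, h is a projection of E_j onto the kernel of the differential.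
    Such an h exists if the cohomology of E is torsion up to degree j: the
    complement c of the torsion of E_j lets c (e - h e), a function of d e, extend
    to E_(j+1), and composing with d gives the next projection. *)
Definition split_mod_tors (E : complex R) j := exists h : {linear E j -> E j},
  (forall e, exists2 z, diff E j z = 0 & tors (h e - z)) /\
  forall z, diff E j z = 0 -> tors (h z - z).

Lemma split_mod_torsS (E : complex R) j : injective_complex E -> tors_at E j ->
  split_mod_tors E j -> split_mod_tors E j.+1.
Proof.
move=> iE tE [h [hZ hE]]; have [t Ht] := tors_retraction noethR I (iE j).
pose c e := e - t e.
have lin_c : linear c by move=> a u v; rewrite /c linearP scalerBr opprD addrACA.
have c0 e : tors e -> c e = 0 by move=> te; rewrite /c (Ht e).2 // subrr.
have [||g Hg] := injective_extend (B := E j.+1)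
  (g := fun b y => exists e, b = diff E j e /\ y = c (e - h e)) (iE j).
- apply: lrelI => [|a b y b' y' [e [-> ->]] [e' [-> ->]]].
    by exists 0; rewrite !linear0 addr0 c0 //; exact: (submodP_tors I _).1.
  exists (a *: e + e'); split; first by rewrite linearP.
  by rewrite -lin_c (linearP h) opprD addrACA -scalerBr.
- move=> y [e [/esym de ->]]; apply: c0; rewrite -opprB.
  by apply: (submodPN (submodP_tors I _)); exact: hE.
exists (diff E j \o g)%FUN; split=> [e|z dz].
  exists (diff E j (g e)); first exact: diffK.
  by rewrite subrr; exact: (submodP_tors I _).1.
have hB e : tors (diff E j (g (diff E j e)) - diff E j e).
  rewrite (Hg _ (c (e - h e))); last by exists e.
  have [z0 dz0 thz] := hZ e.
  set u := e - h e.
  have -> : diff E j (c u) - diff E j e = - (diff E j (h e - z0) + diff E j (t u)).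
    rewrite /c /u !(linearB (diff E j)) dz0 subr0 opprD.
    by rewrite addrAC [_ - _ - diff E j e]addrAC subrr add0r.
  apply: (submodPN (submodP_tors I _)).
  apply: (submodPD (submodP_tors I _)); first exact: tors_linear.
  by apply: tors_linear; exact: (Ht _).1.
apply: tors_ext => a Ia; have [k [y Ey]] := tE z dz a Ia.
by exists k; rewrite scalerBr -linearZ -Ey; exact: hB.
Qed.

(** If d e is torsion, then a^k e is a cocycle for some k, so h e - e is torsion;
    as h e is a cocycle modulo torsion, so is e. *)
Lemma tors_lift (E : complex R) j : injective_complex E -> trivial (E 0) ->
  (forall i, (i < j)%N -> tors_at E i) ->
  forall e : E j, tors (diff E j e) -> exists2 e', tors e' & diff E j e' = diff E j e.
Proof.
move=> iE E0 tE e te.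
have [h [hZ hE]] : split_mod_tors E j.
  elim: j tE {e te} => [|j IHj] tE.
    have t0 (x : E 0) : tors x by rewrite (E0 x); exact: (submodP_tors I _).1.
    by exists \0; split=> [e|z _] //; exists 0; rewrite ?linear0.
  by apply: split_mod_torsS (IHj _) => // [|i lt_ij]; apply: tE; rewrite // ltnW.
have th_e : tors (h e - e).
  apply: tors_ext => a Ia; have [k Ek] := te a Ia; exists k.
  by rewrite scalerBr -linearZ; apply: hE; rewrite linearZ.
have [z dz thz] := hZ e; exists ((h e - z) - (h e - e)).
  exact: (submodPB (submodP_tors I _)).
by rewrite opprB addrC addrA subrK linearB dz subr0.
Qed.

Lemma HNd_exact r (E : complex R) j : injective_complex E -> trivial (E 0) ->
  (forall i, (i < j)%N -> tors_at E i) -> exact_at E j -> HNd r E j.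
Proof.
move=> iE E0 tE ex; apply: ArtNd0 => x [tx /ex[e Ee]].
by rewrite -Ee in tx *; have [e' te' <-] := tors_lift iE E0 tE tx; exists e'.
Qed.

Section ConeCohomology.
Variables (E F : complex R) (f : forall j, {linear E j -> F j}).
Hypothesis fC : forall j e, f j.+1 (diff E j e) = diff F j (f j e).

(** The cocycles whose image under f is the coboundary of a torsion element: modulo
    coboundaries, they are the image of the cohomology of the cone. *)
Definition cone_ker j : E j.+1 -> Prop := fun z => tors_cocycles z /\
  exists2 g : shift F j.+1, tors g & diff (shift F) j.+1 g = f j.+1 z.

Lemma itv_cone_ker j : itv (@tors_coboundaries E j) (@cone_ker j).
Proof.
have [sW sU WU] := itv_cohomology E j; split=> //.
  split; first split; first exact: sU.1.
    by exists 0; [exact: (submodP_tors I _).1|rewrite !linear0].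
  move=> a u v [Zu [g tg Eg]] [Zv [g' tg' Eg']]; split; first exact: sU.2.
  exists (a *: g + g'); first exact: (submodP_tors I _).2.
  by rewrite !linearP Eg Eg'.
move=> x Bx; split; first exact: WU.
by case: Bx => y ty <-; exists (f j y); [exact: tors_linear|rewrite fC].
Qed.

Lemma HNd_cone_ker r j :
  HNd r (cone fC) j -> ArtNd r (@tors_coboundaries E j) (@cone_ker j).
Proof.
apply: ArtNd_dom (itv_cohomology _ _) (itv_cone_ker j) _.
exists (fun (c : cone fC j.+1) z => c.1 = z); split.
- by apply: lrelI => // a c z c' z' <- <-.
- move=> z [[tz dz] [g tg Eg]]; exists (z, g) => //; split.
    move=> a Ia; have [k kz] := tz a Ia; have [n ng] := tg a Ia.
    exists (maxn k n); rewrite -[RHS]/(0, 0); congr (_, _).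
      exact: scaler_expD (leq_maxl k n) kz.
    exact: scaler_expD (leq_maxr k n) ng.
  by rewrite /= /cone_fun /= dz -Eg subrr.
- move=> c z [[e g] tc <-] <- _; exists e => // a /tc[k [ke _]].
  by exists k.
Qed.

End ConeCohomology.

End TorsionSubcomplex.

(** * Resolutions *)

Section Resolutions.
Variable R : comNzRingType.

(** E is a complex of injectives whose only cohomology is M, in degree s.+1: up to
    homotopy an injective resolution of M.  Allowing the degrees below s.+1 to be
    nonzero keeps the notion stable under mapping cones. *)
Definition resolves (s : nat) (M : lmodType R) (E : complex R) : Prop :=
  [/\ injective_complex E, trivial (E 0), forall j, j <> s -> exact_at E j
    & exists rho : E s.+1 -> M -> Prop, [/\ lrel rho,
        forall z, diff E s.+1 z = 0 <-> exists m, rho z m,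
        forall m, exists z, rho z m
      & forall z m, rho z m -> (m = 0 <-> exists y, diff E s y = z)]].

(** A genuine injective resolution N -> F_s -> F_(s+1) -> ... placed in degree s. *)
Record delayed (s : nat) (N : lmodType R) (F : complex R) (iota : N -> F s) : Prop := {
  delayed_injective : injective_complex F;
  delayed_trivial : forall j, (j < s)%N -> trivial (F j);
  delayed_linear : linear iota;
  delayed_inj : forall n, iota n = 0 -> n = 0;
  delayed_im : forall z, diff F s z = 0 <-> exists n, iota n = z;
  delayed_exact : forall j, (s <= j)%N -> exact_at F j
}.

Section StandardResolution.
Variable N : lmodType R.

Fixpoint cosyzygy j : lmodType R :=
  if j is i.+1 then quot_mod (im_submod (to_hull (cosyzygy i))) else N.

Definition std_diff j : {linear hull (cosyzygy j) -> hull (cosyzygy j.+1)} :=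
  (to_hull (cosyzygy j.+1) \o qpi (im_submod (to_hull (cosyzygy j))))%FUN.

Lemma std_diff_eq0 j x : std_diff j x = 0 <-> exists y, to_hull (cosyzygy j) y = x.
Proof.
split=> [/(@to_hull_eq0 _ (cosyzygy j.+1))/qpi_eq0/asboolP//|H].
have Q : qpi (im_submod (to_hull (cosyzygy j))) x = 0 by exact/qpi_eq0/asboolP.
by rewrite -[LHS]/(to_hull (cosyzygy j.+1) (qpi _ x)) Q linear0.
Qed.

Fact std_diffK j x : std_diff j.+1 (std_diff j x) = 0.
Proof. by apply/std_diff_eq0; exists (qpi _ x). Qed.

Definition std_complex := Complex std_diffK.

Lemma delayed_std : delayed (s := 0) (F := std_complex) (to_hull N).
Proof.
split=> //.
- by move=> j; exact: injective_hull.
- exact: linearP.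
- exact: to_hull_eq0.
- exact: (@std_diff_eq0 0).
- move=> j _ x /std_diff_eq0[y <-]; have [z <-] := qpi_surj y.
  by exists z.
Qed.

Lemma delayed_exists s : exists F (iota : N -> obj F s), delayed iota.
Proof.
elim: s => [|s [F [iota [iF F0 lin inj im ex]]]].
  by exists std_complex, (to_hull N); exact: delayed_std.
exists (shift F), iota; split=> //; first exact: injective_shift.
- by case=> [_|j lt_js]; [exact: trivial_rV0|exact: F0].
- by case=> [//|j le_sj]; exact: ex.
Qed.

End StandardResolution.

Lemma delayed_resolves s (N : lmodType R) (F : complex R) (iota : N -> F s.+1) :
  delayed iota -> resolves s N F.
Proof.
case=> iF F0 lin inj im ex; have iota0 := linear0 (mklin lin).
split=> //; first exact: F0.
  move=> j /eqP; rewrite neq_ltn => /orP[lt_js|lt_sj]; last exact: ex.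
  by move=> x _; exists 0; rewrite linear0 [RHS]F0.
exists (fun z n => z = iota n); split.
- by apply: lrelI => // a v x v' x' -> ->; rewrite lin.
- by move=> z; split=> [/im[n <-]|[n ->]]; [exists n|apply/im; exists n].
- by move=> n; exists (iota n).
- move=> _ n ->; split=> [->|[y Ey]]; first by exists 0; rewrite linear0 [RHS]iota0.
  by apply: inj; rewrite -Ey (F0 s (leqnn _) y) linear0.
Qed.

Section Lift.
Variables (s : nat) (M N : lmodType R) (E F : complex R) (g : {linear M -> N}).
Variables (rho : E s.+1 -> M -> Prop) (iota : N -> F s.+1).
Hypotheses (exE : forall j, j <> s -> exact_at E j) (sr : lrel rho).
Hypothesis rhoZ : forall z, diff E s.+1 z = 0 <-> exists m, rho z m.
Hypothesis rhoB : forall z m, rho z m -> (m = 0 <-> exists y, diff E s y = z).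
Hypothesis dF : delayed iota.

(** The transport along p states the condition in degree s.+1 for an index j that
    is only propositionally equal to s.+1. *)
Definition partial_lift j (psi : {linear E j -> F j}) : Prop :=
  (forall z, diff E j z = 0 -> diff F j (psi z) = 0) /\
  forall (p : s.+1 = j) z m, rho z m ->
    psi (ecast i (E i) p z) = ecast i (F i) p (iota (g m)).

Let iota0 : iota 0 = 0. Proof. exact: (linear0 (mklin (delayed_linear dF))). Qed.

(** Below degree s.+1 the target vanishes.  In degree s.+1 the map is prescribed on
    cocycles by g, and in higher degrees on coboundaries by the previous map; both
    prescriptions extend as F is injective. *)
Lemma partial_liftS j psi : @partial_lift j psi ->
  exists2 psi', @partial_lift j.+1 psi' &
    forall e, psi' (diff E j e) = diff F j (psi e).
Proof.
case: dF => iF F0 lin inj im ex [psiZ psis].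
have [lt_js|lt_sj|Ejs] := ltngtP j s.
- exists \0; last by move=> e; rewrite [RHS]F0.
  split=> [z _|p]; first by rewrite linear0.
  by have [Esj] := p; rewrite Esj ltnn in lt_js.
- have [||psi' Hpsi'] := injective_extend (B := E j.+1)
    (g := fun b y => exists2 e, diff E j e = b & diff F j (psi e) = y) (iF j.+1).
  + apply: lrelI => [|a b y b' y' [e <- <-] [e' <- <-]]; first by exists 0; rewrite !linear0.
    by exists (a *: e + e'); rewrite !linearP.
  + by move=> y [e /psiZ -> <-].
  have C e : psi' (diff E j e) = diff F j (psi e) by apply: Hpsi'; exists e.
  exists psi' => //; split=> [z dz|p]; last by have [Esj] := p; rewrite Esj ltnn in lt_sj.
  have [|e <-] := exE (j := j) _ dz; first by move=> Ejs; rewrite Ejs ltnn in lt_sj.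
  by rewrite C diffK.
- rewrite {j}Ejs in psi psiZ psis *.
  have [||psi' Hpsi'] := injective_extend (B := E s.+1)
    (g := fun b y => exists2 m, rho b m & iota (g m) = y) (iF s.+1).
  + apply: lrelI => [|a b y b' y' [m rb <-] [m' rb' <-]].
      by exists 0; rewrite ?linear0 //; exact: lrel0.
    by exists (a *: m + m'); [exact: lrelP|rewrite linearP lin].
  + move=> y [m r0 <-]; suff -> : m = 0 by rewrite linear0.
    by apply/(rhoB r0); exists 0; rewrite linear0.
  exists psi' => [|e]; last first.
    rewrite (F0 s (leqnn _) (psi e)) linear0 -iota0; apply: Hpsi'; exists 0; rewrite ?linear0 //.
    have [m rm] : exists m, rho (diff E s e) m by apply/rhoZ; exact: diffK.
    by suff <- : m = 0 by []; apply/(rhoB rm); exists e.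
  split=> [z /rhoZ[m rm]|p z m rm].
    rewrite (Hpsi' z (iota (g m))); last by exists m.
    by apply/im; exists (g m).
  by rewrite (eq_axiomK p) /=; apply: Hpsi'; exists m.
Qed.

Lemma lift_exists : exists psi : forall j, {linear E j -> F j},
  (forall j e, psi j.+1 (diff E j e) = diff F j (psi j e)) /\
  forall z m, rho z m -> psi s.+1 z = iota (g m).
Proof.
have next j (psi : {psi | @partial_lift j psi}) :
    {psi' : {psi' | @partial_lift j.+1 psi'} |
      forall e, sval psi' (diff E j e) = diff F j (sval psi e)}.
  apply: cid; have [psi' Hpsi' C] := partial_liftS (svalP psi).
  by exists (exist _ psi' Hpsi').
have start : @partial_lift 0 \0 by split=> // z _; rewrite linear0.
pose psi := nat_rect (fun j => {psi | @partial_lift j psi})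
  (exist _ _ start) (fun j p => sval (next j p)).
exists (fun j => sval (psi j)); split=> [j e|z m rm].
  exact: (svalP (next j (psi j))).
exact: ((svalP (psi s.+1)).2 erefl).
Qed.

End Lift.

End Resolutions.

(** * Bounds on local cohomology *)

Section CohomologyBounds.
Variable R : comNzRingType.
Hypothesis noethR : noetherian R.
Variable I : idealr R.
Local Notation tors := (tors I).

(** Quantifying over all resolutions, also those with terms below degree s.+1, lets
    mapping cones play the role of long exact sequences. *)
Definition cohNd r i (M : lmodType R) : Prop :=
  forall s E, resolves s M E -> HNd I r E (i + s).

Lemma cohNd_le r r' i M : (r <= r')%N -> cohNd r i M -> cohNd r' i M.
Proof. by move=> le_r H s E /H; apply: ArtNd_le. Qed.

(** The cone of a lift of g to a resolution F of N resolves L.  So the cohomology of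
    E has a submodule that is a quotient of the cohomology of the cone, with
    quotient embedded in the cohomology of F. *)
Lemma cohNd_ext r i (L M N : lmodType R) (f : {linear L -> M}) (g : {linear M -> N}) :
  (forall l, f l = 0 -> l = 0) -> (forall m, g m = 0 <-> exists l, f l = m) ->
  (forall n, exists m, g m = n) ->
  cohNd r i L -> cohNd r i N -> cohNd r i M.
Proof.
move=> inj_f ker_g surj_g HL HN s E [iE E0 exE [rho [sr rhoZ rhoS rhoB]]].
have [F [iota dF]] := delayed_exists N s.+1.
have [psi [psiC psis]] := lift_exists g exE sr rhoZ rhoB dF.
have resF := delayed_resolves dF; have [iF F0 lin inj im ex] := dF.
have iota0 : iota 0 = 0 := linear0 (mklin lin).
have Fs x : x = 0 :> F s by apply: F0.
have resC : resolves s L (cone psiC).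
  split.
  - exact: injective_cone.
  - by case=> e x; rewrite (E0 e) (trivial_rV0 x).
  - move=> j nj [e h] deh; have [de _] := deh.
    have [e' Ee'] := exE j nj e de; rewrite -Ee' in deh *.
    have [lt_js|lt_sj|//] := ltngtP j s.
      apply: (@cone_exact _ _ _ _ psiC j e' h _ deh) => x _; exists 0; rewrite linear0.
      by case: j lt_js {nj e h de e' Ee' deh} x => [|j] lt_js x; rewrite [RHS]F0 // ltnW.
    case: j lt_sj nj e h de e' Ee' deh => // j; rewrite ltnS leq_eqVlt.
    case/orP=> [/eqP Ejs|lt_sj] nj e h de e' Ee' deh; last first.
      by apply: (@cone_exact _ _ _ _ psiC j.+1 e' h _ deh); exact: ex.
    (* z is a cocycle lifting the class that the defect psi e' - h defines in N *)
    rewrite -{}Ejs in e h de e' Ee' deh *.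
    have [_ E2] := deh; have /im[n En] : diff F s.+1 (psi s.+1 e' - h) = 0.
      by rewrite linearB -psiC.
    have [m Em] := surj_g n; have [z rz] := rhoS m.
    have dz : diff E s.+1 z = 0 by apply/rhoZ; exists m.
    exists (e' - z, 0); rewrite /= /cone_fun /= !linearB dz subr0 (psis _ _ rz) Em En.
    by rewrite linear0 subr0 subKr.
  exists (fun c l => rho c.1 (f l)); split.
  - apply: lrelI => [|a c l c' l' H H']; first by rewrite !linear0; exact: (lrel0 sr).
    by rewrite !linearP; exact: (lrelP sr).
  - case=> e h; have h0 : h = 0 := Fs h; split.
      move=> deh; have [/rhoZ[m rm] E2] := deh.
      have /inj/ker_g[l El] : iota (g m) = 0.
        by rewrite -(psis _ _ rm); move: E2; rewrite h0 linear0 subr0.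
      by exists l; rewrite El.
    case=> l rl; rewrite /= /cone_fun /= h0 linear0 subr0 (psis _ _ rl).
    rewrite (_ : g _ = 0) ?iota0; last by apply/ker_g; exists l.
    by rewrite (_ : diff _ _ _ = 0) //; apply/rhoZ; exists (f l).
  - by move=> l; have [z rz] := rhoS (f l); exists (z, 0).
  - move=> [e h] l /= rl; split=> [l0|].
      have [e' Ee'] : exists e', diff E s e' = e by apply/(rhoB _ _ rl); rewrite l0 linear0.
      by exists (e', 0); rewrite /= /cone_fun /= Ee'; congr (_, _); rewrite [LHS]Fs [RHS]Fs.
    by case=> -[e' h'] [Ee' _]; apply/inj_f/(rhoB _ _ rl); exists e'.
have [sW sU WU] := itv_cohomology I E (i + s).
have iT := itv_cone_ker I psiC (i + s).
have iT' : itv (@cone_ker _ I _ _ psi (i + s)) (@tors_cocycles _ I E (i + s).+1).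
  by split=> [||x []] //; case: iT.
apply: (ArtNd_ext iT iT' (HNd_cone_ker (HL _ _ resC))).
apply: (ArtNd_dom (itv_cohomology _ _ _) iT' _ (HN _ _ resF)).
exists (fun y z => y = psi _ z); split.
- by apply: lrelI => [|a y z y' z' -> ->]; rewrite ?linear0 // linearP.
- move=> z [tz dz]; exists (psi _ z) => //; split; first exact: tors_linear.
  by rewrite -psiC dz linear0.
- by move=> y z [x tx Ex] Ey Zz; split=> //; exists x => //; rewrite -Ey -Ex.
Qed.

(** The cone of multiplication by x starts one degree late: this is where H^(-1) = 0
    enters. *)
Lemma HNd_below r s (M : lmodType R) E j : resolves s M E -> (j < s)%N -> HNd I r E j.
Proof.
case=> iE E0 exE _ lt_js; apply: HNd_exact => // [i lt_ij|].
  apply/exact_tors_at/exE => Eis.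
  by have := ltn_trans lt_ij lt_js; rewrite Eis ltnn.
by apply: exE => Ejs; rewrite Ejs ltnn in lt_js.
Qed.

(** When all cohomology of E is torsion, torsion elements that bound in E bound
    already among torsion elements. *)
Lemma cohNd_tors r i (M : lmodType R) : (forall m : M, tors m) -> cohNd r i.+1 M.
Proof.
move=> tM s E [iE E0 exE [rho [sr rhoZ rhoS rhoB]]].
have nis : (i.+1 + s)%N <> s by move/eqP; rewrite -[X in _ == X]add0n eqn_add2r.
apply: HNd_exact (exE _ nis) => // j _.
have [->|/eqP nj] := eqVneq j s; last exact/exact_tors_at/exE.
move=> z /rhoZ[m rm] a Ia; have [k km] := tM m a Ia; exists k.
by apply/(rhoB _ (a ^+ k *: m)) => //; exact: lrelZ.
Qed.

(** H^0(M) embeds in M. *)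
Lemma cohNd_0 r (M : lmodType R) : ArtNd r (zeroP : M -> Prop) fullP -> cohNd r 0 M.
Proof.
move=> HM s E resE; have [iE E0 exE [rho [sr rhoZ rhoS rhoB]]] := resE.
apply: ArtNd_dom HM.
- by split; [exact: submodP_zero|exact: submodP_full|].
- exact: itv_cohomology.
exists (fun m z => rho z m); split.
- by apply: lrelI => [|a m z m' z' H H']; [exact: lrel0|exact: lrelP].
- by move=> z [_ /rhoZ[m rm]]; exists m.
- move=> m z m0 /rhoB[/(_ m0)[e Ee] _] [tz _]; rewrite -Ee in tz *.
  have [|e' te' <-] := tors_lift noethR iE E0 _ tz; last by exists e'.
  move=> j lt_js; apply/exact_tors_at/exE => Ejs.
  by rewrite Ejs ltnn in lt_js.
Qed.

(** Multiplication by a regular x is a chain map whose cone resolves M/xM, one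
    degree higher; its cohomology maps onto the kernel of x on that of E. *)
Lemma regular_cone (s : nat) (x : R) (M N : lmodType R) (p : {linear M -> N}) E :
  (forall m : M, x *: m = 0 -> m = 0) ->
  (forall m, p m = 0 <-> exists m', x *: m' = m) -> (forall n, exists m, p m = n) ->
  resolves s M E -> exists2 C, resolves s.+1 N C & forall r j, HNd I r C j ->
    ArtNd r (@tors_coboundaries _ I E j)
      (ann_exp x (@tors_coboundaries _ I E j) (@tors_cocycles _ I E j.+1) 1).
Proof.
move=> reg ker_p surj_p [iE E0 exE [rho [sr rhoZ rhoS rhoB]]].
pose psi j : {linear E j -> E j} := *:%R x.
have psiC j e : psi j.+1 (diff E j e) = diff E j (psi j e) by rewrite /= linearZ.
have sh_ex j : j <> s.+1 -> exact_at (shift E) j.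
  case: j => [_ e _|j nj]; first by exists 0; rewrite linear0 [RHS]E0.
  by apply: exE => Ejs; apply: nj; rewrite Ejs.
have resC : resolves s.+1 N (cone psiC).
  split.
  - exact: injective_cone.
  - by case=> e z; rewrite (E0 e) (trivial_rV0 z).
  - move=> j njs [e h] deh; have [de /eqP] := deh; rewrite subr_eq0 => /eqP xe.
    have [e' Ee'] : exists e', diff E j e' = e.
      have [Ejs|/eqP nj] := eqVneq j s; last exact: exE.
      rewrite {}Ejs in e h {deh} de xe njs *; have /rhoZ[m rm] := de.
      apply/(rhoB _ _ rm)/reg/(rhoB (x *: e)); first exact: (lrelZ sr).
      by exists h.
    rewrite -Ee' in deh *.
    by apply: (@cone_exact _ _ _ _ psiC j e' h _ deh); exact: sh_ex.
  exists (fun (c : cone psiC s.+2) n => exists e m,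
    [/\ diff E s.+1 e = c.1, rho (c.2 - x *: e) m & p m = n]).
  split.
  - apply: lrelI => [|a c n c' n' [e [m [E1 rm <-]]] [e' [m' [E1' rm' <-]]]].
      by exists 0, 0; rewrite scaler0 subr0 !linear0; split=> //; exact: (lrel0 sr).
    exists (a *: e + e'), (a *: m + m'); split; first by rewrite linearP E1 E1'.
      rewrite [_.2](_ : _ = a *: c.2 + c'.2) // scalerDr scalerA mulrC -scalerA.
      by rewrite opprD addrACA -scalerBr; exact: (lrelP sr).
    exact: linearP.
  - case=> e h; split.
      case=> de /eqP; rewrite subr_eq0 => /eqP xe.
      have [e' Ee'] : exists e', diff E s.+1 e' = e.
        by apply: exE => // /eqP; rewrite -[X in _ == X]addn0 -addn1 eqn_add2l.
      have [m rm] : exists m, rho (h - x *: e') m.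
        have xe' : x *: e = diff E s.+1 h := xe.
        by apply/rhoZ; rewrite linearB linearZZ Ee' xe' subrr.
      by exists (p m), e', m.
    case=> n [e' [m [/= <- rm _]]]; rewrite /cone_fun /= diffK.
    have /(_ (ex_intro _ m rm)) := (rhoZ (h - x *: e')).2.
    by rewrite linearB linearZZ => /eqP; rewrite subr_eq0 => /eqP ->; rewrite subrr.
  - move=> n; have [m <-] := surj_p n; have [z rz] := rhoS m.
    by exists (0, z), 0, m; rewrite scaler0 subr0 linear0.
  - move=> [e h] n [e' [m [/= <- rm <-]]]; split.
      move=> /ker_p[m' Em]; have [z' rz'] := rhoS m'.
      have [g Eg] : exists g, diff E s g = h - x *: e' - x *: z'.
        apply/(rhoB _ (m - x *: m')); last by rewrite Em subrr.
        by apply: (lrelB sr) => //; exact: (lrelZ sr).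
      exists (e' + z', - g); rewrite /cone_fun /= linearD.
      rewrite (_ : diff E s.+1 z' = 0) ?addr0; last by apply/rhoZ; exists m'.
      congr (_, _); rewrite linearN opprK Eg scalerDr.
      rewrite -[h - _ - _]addrA -opprD [LHS]addrC; exact: subrK.
    move=> [[e1 g1] [Ee1 Eh]].
    have [m1 rm1] : exists m1, rho (e1 - e') m1.
      by apply/rhoZ; rewrite linearB Ee1 subrr.
    apply/ker_p; exists m1; apply/esym/subr0_eq.
    apply/(rhoB _ _ (lrelB sr rm (lrelZ sr x rm1))); exists (- g1).
    have Eh' : h = x *: e1 - diff E s g1 by [].
    rewrite linearN scalerBr Eh' [in RHS](addrAC _ _ (- (x *: e'))).
    by rewrite [RHS]addrAC subrr sub0r.
exists (cone psiC) => // r j /HNd_cone_ker.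
apply: ArtNd_dom; [exact: itv_cone_ker|exact/itv_ann_exp/itv_cohomology|].
exact: dom_incl.
Qed.

Section Regular.
Variables (x : R) (M N : lmodType R) (p : {linear M -> N}).
Hypothesis Ix : x \in I.
Hypothesis reg : forall m : M, x *: m = 0 -> m = 0.
Hypothesis ker_p : forall m, p m = 0 <-> exists m', x *: m' = m.
Hypothesis surj_p : forall n, exists m, p m = n.

Lemma cocycles_tors (E : complex R) j (u : E j.+1) : tors_cocycles I u ->
  exists k, @tors_coboundaries _ I E j (x ^+ k *: u).
Proof.
case=> /(_ x Ix)[k Ek] _; exists k; rewrite Ek.
exact: (submodP0 (let: And3 sW _ _ := itv_cohomology I E j in sW)).
Qed.

Lemma HNd_zero_ann (E : complex R) j :
  ArtNd 0 (@tors_coboundaries _ I E j)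
    (ann_exp x (@tors_coboundaries _ I E j) (@tors_cocycles _ I E j.+1) 1) -> HNd I 0 E j.
Proof.
case=> _ H; apply/ArtNd0/(tors_zero (itv_cohomology I E j) (@cocycles_tors E j)).
by move=> u Uu Wxu; apply: H; split=> //; rewrite expr1.
Qed.

Lemma cohNd_regular_0 : cohNd 0 0 M.
Proof.
move=> s E /(regular_cone reg ker_p surj_p)[C resC HC].
apply: HNd_zero_ann; apply: HC; exact: HNd_below resC _.
Qed.

Lemma cohNd_regular_zero i : cohNd 0 i N -> cohNd 0 i.+1 M.
Proof.
move=> HN s E /(regular_cone reg ker_p surj_p)[C resC HC].
by apply: HNd_zero_ann; apply: HC; rewrite addSnnS; exact: HN resC.
Qed.

Lemma cohNd_regularS r i : cohNd r i N -> cohNd r.+1 i.+1 M.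
Proof.
move=> HN s E /(regular_cone reg ker_p surj_p)[C resC HC].
apply: (ArtNd_tors (itv_cohomology I E _) (@cocycles_tors E _)); apply: HC.
by rewrite addSnnS; exact: HN resC.
Qed.

End Regular.

End CohomologyBounds.

(** * Dimension and devissage *)

Section Devissage.
Variable R : comNzRingType.
Hypothesis noethR : noetherian R.
Variable I : idealr R.
Implicit Types J : R^o -> Prop.

(** dim R/J < e. *)
Definition dim_lt J (e : nat) : Prop := forall n (p : nat -> prime_idealr R),
  (forall i, (i <= n)%N -> forall a, J a -> a \in p i) ->
  (forall i, (i < n)%N -> {subset p i <= p i.+1} /\ ~ {subset p i.+1 <= p i}) ->
  (n < e)%N.

Lemma dim_lt_sub J J' e : (forall a, J a -> J' a) -> dim_lt J e -> dim_lt J' e.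
Proof. by move=> JJ' H n p pJ; apply: H => i le_in a /JJ'; apply: pJ. Qed.

Definition primeP J : Prop := ~ J 1 /\ forall a b : R, J (a * b) -> J a \/ J b.

Lemma prime_idealr_of J : submodP J -> primeP J ->
  exists P : prime_idealr R, forall a, a \in P <-> J a.
Proof.
move=> sJ [J1 JM]; pose P : {pred R} := fun a => `[< J a >].
have PE a : reflect (J a) (a \in P) by exact: asboolP.
have iP : idealr_closed P.
  split; [by apply/PE; exact: sJ.1|exact/PE|move=> a u v /PE Ju /PE Jv; apply/PE].
  exact: sJ.2.
have pP : prime_idealr_closed P.
  by move=> a b /PE/JM[|] /PE ->; rewrite ?orbT.
pose PI : prime_idealr R := HB.pack P (isIdealr.Build R P iP)
  (isPrimeIdealrClosed.Build R P pP).
by exists PI => a; split=> [/PE|/PE].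
Qed.

Lemma dim_lt_prime0 J : submodP J -> primeP J -> ~ dim_lt J 0.
Proof.
move=> sJ /(prime_idealr_of sJ)[P PJ] dJ; suff : (0 < 0)%N by [].
by apply: (dJ 0%N (fun=> P)) => // i _ a /PJ.
Qed.

Definition addI J (x : R) : R^o -> Prop := fun b => exists c : R, J (b - c * x).
Definition colonI J (x : R) : R^o -> Prop := fun b => J (b * x).

Lemma submodP_addI J x : submodP J -> submodP (addI J x).
Proof.
move=> sJ; split=> [|d u v [c Jc] [c' Jc']]; first by exists 0; rewrite mul0r subr0; exact: sJ.1.
by exists (d * c + c'); rewrite mulrDl opprD addrACA -mulrA -mulrBr; exact: sJ.2.
Qed.

Lemma submodP_colonI J x : submodP J -> submodP (colonI J x).
Proof.
move=> sJ; split=> [|d u v Ju Jv]; first by rewrite /colonI mul0r; exact: sJ.1.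
by rewrite /colonI mulrDl -mulrA; exact: sJ.2.
Qed.

Lemma sub_addI J x a : J a -> addI J x a.
Proof. by move=> Ja; exists 0; rewrite mul0r subr0. Qed.

Lemma sub_colonI J x a : submodP J -> J a -> colonI J x a.
Proof. by move=> sJ Ja; rewrite /colonI mulrC; exact: (submodPZ sJ). Qed.

Lemma addI_mem J (x : R) : submodP J -> addI J x x.
Proof. by move=> sJ; exists 1; rewrite mul1r subrr; exact: sJ.1. Qed.

(** A chain of primes over J + (x) is extended at the bottom by J. *)
Lemma dim_lt_addI J x e : submodP J -> primeP J -> ~ J x ->
  dim_lt J e.+1 -> dim_lt (addI J x) e.
Proof.
move=> sJ pJ Jx H n p pJx cp; have [P PJ] := prime_idealr_of sJ pJ.
suff : (n.+1 < e.+1)%N by [].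
apply: (H n.+1 (fun i => if i is j.+1 then p j else P)).
  by move=> [_ a /PJ //|i le_in a Ja]; apply: pJx => //; exact: sub_addI.
move=> [_|i lt_in]; last exact: cp.
split=> [a /PJ Ja|pP]; first by apply: pJx => //; exact: sub_addI.
by apply/Jx/PJ/pP/pJx => //; exact: addI_mem.
Qed.

Lemma not_prime J : ~ J 1 -> ~ primeP J ->
  exists a b : R, [/\ J (a * b), ~ J a & ~ J b].
Proof.
move=> J1 nP; apply: contrapT => H; apply: nP; split=> // a b Jab.
have [Ja|nJa] := pselect (J a); first by left.
by right; apply: contrapT => nJb; apply: H; exists a, b.
Qed.

(** A proper ideal lies in a prime one: one that is maximal among those for which
    this fails would be prime, or else contain a product ab of elements outside it
    and be smaller than the proper ideal (J : a). *)
Lemma dim_lt0 J : submodP J -> dim_lt J 0 -> J 1.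
Proof.
move=> sJ; apply: (noetherian_ind noethR (P := fun J => dim_lt J 0 -> J 1)) sJ.
move=> {}J sJ IHJ dJ.
apply: contrapT => J1.
have [pJ|/(not_prime J1)[a [b [Jab Ja Jb]]]] := pselect (primeP J).
  exact: dim_lt_prime0 dJ.
apply: Ja; rewrite -[a]mul1r; apply: (IHJ (colonI J a) b) => //.
- exact: submodP_colonI.
- by move=> c; exact: sub_colonI.
- by rewrite /colonI mulrC.
- by apply: dim_lt_sub dJ => c; exact: sub_colonI.
Qed.

(** N is isomorphic to R/J, with z corresponding to 1. *)
Definition cyclic (N : lmodType R) (z : N) J : Prop :=
  (forall n, exists a, n = a *: z) /\ forall a, a *: z = 0 <-> J a.

Section Span.
Variables (V : lmodType R) (z : V).

Definition span1 : {pred V} := fun v => `[< exists c, v = c *: z >].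

Lemma span1P v : reflect (exists c, v = c *: z) (v \in span1).
Proof. exact: asboolP. Qed.

Fact span1_closed : submod_closed span1.
Proof.
split=> [|a u v]; first by apply/span1P; exists 0; rewrite scale0r.
move=> /span1P[c ->] /span1P[c' ->]; apply/span1P; exists (a * c + c').
by rewrite scalerDl scalerA.
Qed.

HB.instance Definition _ := GRing.isSubmodClosed.Build R V span1 span1_closed.

Fact span1_gen_subproof : z \in span1.
Proof. by apply/span1P; exists 1; rewrite scale1r. Qed.

Definition span1_gen : submod span1 := Submod span1_gen_subproof.

Lemma cyclic_span1 : cyclic span1_gen (fun a => a *: z = 0).
Proof.
split=> [[v vz]|a]; first by have /span1P[c Ec] := vz; exists c; exact: val_inj.
by split=> [/(congr1 val)|az] //; exact: val_inj.
Qed.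

End Span.

Lemma span1_qpi (V : lmodType R) (z v : V) :
  qpi (span1 z) v = 0 <-> exists c, v = c *: z.
Proof. by split=> [/qpi_eq0/span1P|/span1P/qpi_eq0]. Qed.

Lemma cyclic_quot (V : lmodType R) (z : V) J a :
  cyclic z J -> cyclic (qpi (span1 (a *: z)) z) (addI J a).
Proof.
move=> [zG zJ]; split=> [n|c].
  have [v <-] := qpi_surj n; have [c ->] := zG v.
  by exists c; rewrite linearZZ.
rewrite -linearZZ span1_qpi; split=> -[d Ed]; exists d.
  by apply/zJ; rewrite scalerBl Ed scalerA subrr.
by apply: subr0_eq; rewrite scalerA -scalerBl; exact/zJ.
Qed.

Lemma cohNd_span1 r i (V : lmodType R) (z : V) :
  cohNd I r i (submod (span1 z)) -> cohNd I r i (quot_mod (span1 z)) ->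
  cohNd I r i V.
Proof.
have lin : linear (val : submod (span1 z) -> V) by [].
apply: (cohNd_ext (f := mklin lin) (g := qpi (span1 z))).
- by move=> l l0; exact: val_inj.
- move=> m; split=> [/qpi_eq0 mz|[l <-]]; first by exists (Submod mz).
  by apply/qpi_eq0; exact: valP.
- exact: qpi_surj.
Qed.

Lemma cohNd_trivial r i (N : lmodType R) : trivial N -> cohNd I r i N.
Proof.
move=> N0; case: i => [|i].
  by apply: cohNd_0 => //; apply: ArtNd0 => n _; exact: N0.
by apply: cohNd_tors => // m a _; exists 0%N; rewrite [RHS]N0 [LHS]N0.
Qed.

Lemma ArtNd_simple (N : lmodType R) :
  (forall Y : N -> Prop, submodP Y -> forall y, Y y -> y <> 0 -> forall n, Y n) ->
  ArtNd 1 (zeroP : N -> Prop) fullP.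
Proof.
move=> simple; split=> [Y [sY ZY _] cY|Y [sY ZY _] cY].
  have [[n nY]|full] := pselect (exists n, exists x, ~ Y n x); last first.
    by exists 0%N => k _ x _; apply: contrapT => Yx; apply: full; exists k, x.
  exists n => k le_nk x Yx; have [->|/eqP x0] := eqVneq x 0; first exact: (sY k).1.
  by case: nY => y []; exact: simple Yx x0 y.
have [[n [y [Yy y0]]]|zero] := pselect (exists n y, Y n y /\ y <> 0).
  exists n => k le_nk x _; apply: (simple (Y k)) y0 x => //.
  exact: (chain_le cY le_nk).
exists 0%N => k _ x Yx; have [->|/eqP x0] := eqVneq x 0; first exact: (sY k).1.
by case: zero; exists k.+1, x.
Qed.

(** R/J is then a field. *)
Lemma ArtNd_cyclic_prime (N : lmodType R) (z : N) J :
  submodP J -> primeP J -> dim_lt J 1 -> cyclic z J -> ArtNd 1 (zeroP : N -> Prop) fullP.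
Proof.
move=> sJ pJ dJ [zG zJ]; apply: ArtNd_simple => Y sY y Yy y0 n.
have [a Ea] := zG y; have [b ->] := zG n.
have Ja : ~ J a by move=> /zJ; rewrite -Ea.
have [c /zJ] := dim_lt0 (submodP_addI a sJ) (dim_lt_addI sJ pJ Ja dJ).
rewrite scalerBl scale1r => /subr0_eq ->.
by rewrite -scalerA -Ea; do 2!apply: (submodPZ sY).
Qed.

(** The bound on N.dim H^i(N) when dim N < e: H^i vanishes for i >= e. *)
Definition bound (e i : nat) : nat := if (e <= i)%N then 0%N else e.

(** If ab lies in J but a and b do not, N is an extension of R/(J + a) by R/(J : a),
    and both ideals are larger than J.  If J is prime, either it contains I and N
    is torsion, or some x in I is regular on N and N/xN has smaller dimension. *)
Lemma cohNd_cyclic e i J (N : lmodType R) (z : N) :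
  submodP J -> dim_lt J e -> (e <= i.+1)%N -> cyclic z J ->
  cohNd I (bound e i) i N.
Proof.
elim: e i J N z => [|e IHe] i J N z sJ.
  move=> /(dim_lt0 sJ) J1 _ [zG zJ]; apply: cohNd_trivial => n.
  by have [a ->] := zG n; rewrite -[a]mulr1 -scalerA (zJ 1).2 ?scaler0.
move=> dJ le_ei; move: J sJ dJ N z; apply: (noetherian_ind noethR) => J sJ IHJ dJ N z [zG zJ].
have [pJ|npJ] := pselect (primeP J); last first.
  have [J1|/not_prime/(_ npJ)[a [b [Jab Ja Jb]]]] := pselect (J 1).
    apply: cohNd_trivial => n.
    by have [a ->] := zG n; rewrite -[a]mulr1 -scalerA (zJ 1).2 ?scaler0.
  apply: (cohNd_span1 (z := a *: z)).
    apply: (IHJ (colonI J a) b _ _ _ _ _ _ (span1_gen (a *: z))) => //.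
    - exact: submodP_colonI.
    - by move=> c; exact: sub_colonI.
    - by rewrite /colonI mulrC.
    - by apply: dim_lt_sub dJ => c; exact: sub_colonI.
    - have [gG gJ] := cyclic_span1 (a *: z); split=> // c.
      by rewrite gJ scalerA; exact: zJ.
  apply: (IHJ (addI J a) a _ _ _ _ _ _ (qpi _ z)) => //.
  - exact: submodP_addI.
  - by move=> c; exact: sub_addI.
  - exact: addI_mem.
  - by apply: dim_lt_sub dJ => c; exact: sub_addI.
  - exact: cyclic_quot.
have [IJ|/existsNP[x /not_implyP[Ix Jx]]] := pselect (forall a, a \in I -> J a).
  case: i le_ei {IHJ} => [|i] le_ei; last first.
    apply: cohNd_tors => // n a /IJ Ja; have [c ->] := zG n; exists 1%N.
    by rewrite expr1 scalerA mulrC -scalerA (zJ a).2 ?scaler0.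
  have e0 : e = 0%N by apply/eqP; rewrite -leqn0.
  rewrite {}e0 in dJ *; apply: cohNd_0 => //.
  exact: (ArtNd_cyclic_prime sJ pJ dJ (conj zG zJ)).
have reg (n : N) : x *: n = 0 -> n = 0.
  have [c ->] := zG n; rewrite scalerA => /zJ Jxc; apply/zJ.
  by case: pJ => _ /(_ _ _ Jxc)[].
have ker_p (n : N) : qpi (span1 (x *: z)) n = 0 <-> exists n', x *: n' = n.
  rewrite span1_qpi; split=> [[c ->]|[n' <-]].
    by exists (c *: z); rewrite !scalerA mulrC.
  by have [c ->] := zG n'; exists c; rewrite !scalerA mulrC.
have surj_p := @qpi_surj _ _ (span1 (x *: z)).
case: i le_ei {IHJ} => [|i] le_ei.
  apply: cohNd_le (cohNd_regular_0 noethR Ix reg ker_p surj_p).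
  by [].
have : cohNd I (bound e i) i (quot_mod (span1 (x *: z))).
  apply: (IHe _ (addI J x) _ (qpi _ z)) => //.
  - exact: submodP_addI.
  - exact: dim_lt_addI.
  - exact: cyclic_quot.
rewrite /bound ltnS; case: leqP => _.
  exact: (cohNd_regular_zero Ix reg ker_p surj_p).
exact: (cohNd_regularS Ix reg ker_p surj_p).
Qed.

Definition annP (V : lmodType R) : R^o -> Prop := fun a => forall v : V, a *: v = 0.

(** A module with n.+1 generators is an extension of one with n generators by a
    cyclic one. *)
Lemma cohNd_fin_gen e i n (V : lmodType R) (s : 'I_n -> V) :
  (forall v, exists c : 'I_n -> R, v = \sum_k c k *: s k) ->
  dim_lt (annP V) e -> (e <= i.+1)%N -> cohNd I (bound e i) i V.
Proof.
move=> sG dV le_ei; elim: n V s sG dV => [|n IHn] V s sG dV.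
  by apply: cohNd_trivial => v; have [c ->] := sG v; rewrite big_ord0.
apply: (cohNd_span1 (z := s ord0)).
  apply: cohNd_cyclic le_ei (cyclic_span1 (s ord0)).
    split=> [|a u v su sv]; first exact: scale0r.
    by rewrite scalerDl -scalerA su sv scaler0 addr0.
  by apply: dim_lt_sub dV => a aV; exact: aV.
apply: (IHn _ (fun k => qpi _ (s (lift ord0 k)))).
  move=> w; have [v <-] := qpi_surj w; have [c ->] := sG v.
  exists (fun k => c (lift ord0 k)); rewrite big_ord_recl linearD.
  rewrite (_ : qpi _ (_ *: _) = 0) ?add0r; last by apply/span1_qpi; exists (c ord0).
  by rewrite linear_sum; apply: eq_bigr => k _; rewrite linearZZ.
apply: dim_lt_sub dV => a aV w; have [v <-] := qpi_surj w.
by rewrite -linearZZ aV linear0.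
Qed.

End Devissage.

Section LocalCohomology.
Variables (R : comNzRingType) (M : lmodType R) (E : injective_resolution M).

Fact res_diffK i x : res_diff E i.+1 (res_diff E i x) = 0.
Proof. by apply/res_exact; exists x. Qed.

Definition res_complex : complex R := Complex res_diffK.

Lemma resolves_res : resolves 0 M (shift res_complex).
Proof.
split.
- exact/injective_shift/res_injective.
- exact: trivial_rV0.
- by case=> // j _ x /res_exact.
exists (fun z m => res_aug E m = z); split.
- by apply: lrelI => [|a v x v' x' <- <-]; [exact: linear0|exact: linearP].
- by move=> z; exact: res_exact0.
- by move=> m; exists (res_aug E m).
- move=> z m <-; split=> [->|[y Ey]]; first by exists 0; rewrite !linear0.
  by apply: (@res_aug_inj _ _ E); rewrite -Ey linear0.
Qed.

Lemma coboundary_shift (I : idealr R) d (w : Gamma I (res_obj E d)) y :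
  noetherian R -> tors I y -> diff (shift res_complex) d y = val w ->
  w \in Defs.coboundaries (fun j => Gamma_map I (res_diff E j)) d.
Proof.
case: d w y => [|d] w y noethR ty Ey; first by apply/eqP/val_inj; rewrite /= -Ey.
apply/asboolP; exists (Submod (proj2 (tors_torsion noethR I y) ty)).
exact: val_inj.
Qed.

Lemma local_cohomology_Nd (I : idealr R) r d : noetherian R ->
  HNd I r (shift res_complex) d ->
  Nd r (zeroP : local_cohomology I E d -> Prop) fullP.
Proof.
move=> noethR [_]; apply: Nd_dom; first exact: itv_cohomology.
  by split; [exact: submodP_zero|exact: submodP_full|].
pose K := ker_submod (Gamma_map I (res_diff E d)).
pose B := Defs.coboundaries (fun j => Gamma_map I (res_diff E j)) d.
have -> : local_cohomology I E d = quot_mod (@restr_pred _ _ K B) by [].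
exists (fun z q => exists2 u : submod K, val (val u) = z & qpi (@restr_pred _ _ K B) u = q).
split.
- apply: lrelI => [|a v x v' x' [u <- <-] [u' <- <-]].
    by exists 0 => //; exact: linear0.
  by exists (a *: u + u') => //; exact: linearP.
- move=> q _; have [u <-] := qpi_surj q; exists (val (val u)); last by exists u.
  split; first exact/(tors_torsion noethR)/valP.
  by have /eqP/(congr1 val) := valP u.
move=> z q [y ty Ey] [u Eu <-] _; apply/qpi_eq0.
have : val u \in B by apply: (coboundary_shift noethR ty); rewrite Eu.
by [].
Qed.

End LocalCohomology.

Theorem proposition2p3 (R : comNzRingType) (m : idealr R) (M : lmodType R)
    (d : nat) (I : idealr R) (E : injective_resolution M) :
  noetherian R -> local_ring m ->
  (exists x : M, x != 0) -> fin_gen (predT : {pred M}) -> krull_dim M d ->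
  exists r : int, Ndim (local_cohomology I E d) r /\ (r <= d%:Z)%R.
Proof.
move=> noethR _ _ [n [s [_ sG]]] [_ dimM].
have H : cohNd I (bound d.+1 d) d M.
  apply: (cohNd_fin_gen noethR I (s := s)) => // [v|k p pM cp]; first exact: sG.
  by rewrite ltnS; apply: (dimM k p).
apply/Ndim_of_Ndim_lt/Ndim_lt_of_Nd/(local_cohomology_Nd noethR).
by have := H _ _ (resolves_res E); rewrite /bound ltnn addn0.
Qed.
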